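(* Let $\mathcal{H}$ be a complex Hilbert space and let $\alpha\in[0,1]$. Let $T=(T_{ij})$ be an $n\times n$ operator matrix, where $T_{ij}\in\mathcal{B}(\mathcal{H})$. Let $f,g$ be two non-negative continuous functions on $[0,\infty)$ such that $f(t)g(t)=t$ for all $t\ge0$. If $p\ge1$, then $$\|T\|_{\alpha}^p\le\sqrt{\left\|\alpha|R|^{2p}+(1-\alpha)|S|^{2p}\right\|},$$ where $R=(r_{ij})_{n\times n}$ with $$r_{ij}=\begin{cases}\frac12\left\|f^2(|T_{ii}|)+g^2(|T_{ii}^*|)\right\| & \text{if } i=j,\\ \frac12\left(\|f^2(|T_{ij}|)\|^{\frac12}\|g^2(|T_{ij}^*|)\|^{\frac12}+\|f^2(|T_{ji}|)\|^{\frac12}\|g^2(|T_{ji}^*|)\|^{\frac12}\right) & \text{if } i\ne j,\end{cases}$$ and $S=(s_{ij})_{n\times n}$ with $s_{ij}=\|T_{ij}\|$.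
   Context: $\mathcal{B}(\mathcal{H})$ is the space of bounded linear operators on $\mathcal{H}$, and $\|\cdot\|$ is the usual operator norm. An $n\times n$ operator matrix $T=(T_{ij})$ acts on the Hilbert space direct sum $\oplus_{i=1}^n\mathcal{H}$ by $(Tx)_i=\sum_{j}T_{ij}x_j$. For a bounded operator $T$ on a complex Hilbert space $\mathcal{K}$: $|T|=(T^*T)^{1/2}$; and for $\alpha\in[0,1]$ the $\alpha$-norm is $\|T\|_{\alpha}=\sup\left\{\sqrt{\alpha|\langle Tx,x\rangle|^2+(1-\alpha)\|Tx\|^2}: x\in\mathcal{K},\ \|x\|=1\right\}$. Here $p$ is a real number, and expressions $f^2(|T|)=(f(|T|))^2$, $g^2(|T^*|)=(g(|T^*|))^2$ and $|R|^{2p}$, $|S|^{2p}$ are understood via the continuous functional calculus. Scalar $n\times n$ matrices (such as $R,S$) are regarded as operators on $\mathbb{C}^n$ with the standard inner product. *)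

(* Defs.v *)
From HB Require Import structures.
From mathcomp Require Import all_boot all_order all_algebra.
From mathcomp Require Import sesquilinear complex ring.
From mathcomp Require Import all_classical all_reals all_analysis.

Set Implicit Arguments.
Unset Strict Implicit.
Unset Printing Implicit Defensive.

Import Order.TTheory GRing.Theory Num.Theory.
Import numFieldNormedType.Exports.
Local Open Scope classical_set_scope.
Local Open Scope ring_scope.

Section dot_theory.
Variables (C : numClosedFieldType) (U : lmodType C).
Variable form : {dot U for (@Num.conj C)}.

Lemma dot_CauchySchwarz (u v : U) :
  `|form u v| ^+ 2 <= form u u * form v v.
Proof.
have [->|v0] := eqVneq v 0; first by rewrite !(linear0r form) normr0 expr0n mulr0.
have vv : 0 < form v v by rewrite dnorm_gt0.
have vu : form v u = (form u v)^* by rewrite [LHS](hermC form) mul1r.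
have : 0 <= form (form v v *: u - form u v *: v) (form v v *: u - form u v *: v).
  exact: dnorm_ge0.
rewrite dnormB !dnormZ (linearZl_LR form) (linearZr_LR form)/= (gtr0_norm vv).
set d := form u v; set w := form v v; set x := form u u.
have wE : w^* = w by rewrite geC0_conj// ltW.
rewrite !rmorphM/= wE conjCK normCK.
have -> : w ^+ 2 * x + d * d^* * w - (w * (d^* * d) + w * (d * d^*)) =
          w * (x * w - d * d^*) by ring.
by rewrite pmulr_rge0// subr_ge0.
Qed.

Lemma dot_triangle (u v : U) :
  sqrtC (form (u + v) (u + v)) <= sqrtC (form u u) + sqrtC (form v v).
Proof.
have sge0 w : 0 <= sqrtC (form w w) by rewrite sqrtC_ge0 dnorm_ge0.
rewrite -ler_sqr ?nnegrE ?addr_ge0// sqrrD !sqrtCK dnormD.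
rewrite [leRHS]addrAC (lerD2l (form u u + form v v)).
have -> : form u v + (form u v)^* = 'Re (form u v) *+ 2.
  by rewrite -mulr_natr ReE divfK// pnatr_eq0.
rewrite lerMn2r/=.
have h : `|form u v| <= sqrtC (form u u) * sqrtC (form v v).
  rewrite -ler_sqr ?nnegrE ?mulr_ge0// exprMn !sqrtCK.
  exact: dot_CauchySchwarz.
by apply: le_trans h; case: (leif_Re_Creal (form u v)).
Qed.
End dot_theory.

Local Open Scope complex_scope.

HB.mixin Record CompleteNormedModule_isHilbert (R : realType) V
    & CompleteNormedModule R[i] V := {
  inner : {dot V for (@Num.conj R[i])} ;
  innerE : forall x : V, inner x x = `|x| ^+ 2
}.

#[short(type="hilbertType")]
HB.structure Definition Hilbert (R : realType) :=
  {V of CompleteNormedModule R[i] V & CompleteNormedModule_isHilbert R V}.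

(* Norms over R[i] take their values in R[i]; rnorm is the same number in R. *)
Definition rnorm (R : realType) (V : normedZmodType R[i]) (x : V) : R :=
  complex.Re `|x|.

Section rnorm_theory.
Variables (R : realType) (V : normedZmodType R[i]).
Implicit Types x y : V.

Lemma rnormE x : (rnorm x)%:C = `|x|.
Proof.
by apply/eqP; rewrite eq_complex /= (ger0_Im (normr_ge0 x)) !eqxx.
Qed.

Lemma rnorm_ge0 x : 0 <= rnorm x.
Proof. by rewrite -ler0c rnormE. Qed.

Lemma ler_rnormD x y : rnorm (x + y) <= rnorm x + rnorm y.
Proof. by rewrite -lecR rmorphD/= !rnormE ler_normD. Qed.

Lemma rnorm0 : rnorm (0 : V) = 0.
Proof. by rewrite /rnorm normr0. Qed.

Lemma ler_rnorm_sum (I : Type) (r : seq I) (F : I -> V) :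
  rnorm (\sum_(i <- r) F i) <= \sum_(i <- r) rnorm (F i).
Proof.
elim/big_rec2: _ => [|i a b _ ab]; first by rewrite rnorm0.
by apply: (le_trans (ler_rnormD _ _)); rewrite lerD2l.
Qed.

End rnorm_theory.

Lemma rnormZ (R : realType) (V : normedModType R[i]) (a : R[i]) (x : V) :
  rnorm (a *: x) = rnorm a * rnorm x.
Proof. by apply: complexI; rewrite rmorphM/= !rnormE normrZ. Qed.

(* The complex numbers as a Hilbert space, with <x, y> = x * conj y. The alias
   keeps this norm topology away from the ring structures of R[i]. *)
Definition cline (R : realType) : Type := R[i].

Section complex_hilbert.
Variable R : realType.
Local Notation C := (cline R).

HB.instance Definition _ := NormedModule.copy C R[i]^o.

Lemma complex_complete (F : set_system C) :
  ProperFilter F -> cauchy F -> cvg F.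
Proof.
move=> FF Fc.
have cvgp (p : R[i] -> R) : {morph p : x y / x - y} ->
    (forall z, `|p z|%:C <= `|z|) -> cvg (p @ F).
  move=> pB hp; apply: cauchy_cvg; apply/cauchyP => e e0.
  have [|x Fx] := (cauchyP F).1 Fc e%:C; first by rewrite ltcR.
  exists (p x); rewrite nbhs_simpl /=; apply: filterS Fx => z /=.
  rewrite -!ball_normE /= => xz; rewrite -ltcR -pB.
  exact: le_lt_trans (hp _) xz.
have leRe (z : R[i]) : `|complex.Re z|%:C <= `|z| by exact: normc_ge_Re.
have leIm (z : R[i]) : `|complex.Im z|%:C <= `|z|.
  rewrite -[X in X%:C]normrN -ReiNIm; apply: le_trans (leRe _) _.
  rewrite normrM; have -> : `|'i| = 1 :> R[i]; last by rewrite mulr1.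
  by rewrite normc_def/= expr0n/= expr1n add0r sqrtr1.
have ReB : {morph @complex.Re R : x y / x - y} by case=> ? ? [? ?].
have ImB : {morph @complex.Im R : x y / x - y} by case=> ? ? [? ?].
have /cvg_ex[/= a Fa] := cvgp (@complex.Re R) ReB leRe.
have /cvg_ex[/= b Fb] := cvgp (@complex.Im R) ImB leIm.
apply/cvg_ex; exists (a +i* b : C).
apply/cvgrPdist_lt => e; rewrite ltcE => /andP[/eqP/= ei e0].
have e20 : 0 < complex.Re e / 2 by rewrite divr_gt0.
have eE : e = (complex.Re e / 2)%:C + (complex.Re e / 2)%:C.
  by rewrite -rmorphD/= -splitr; case: (e) ei => /= ? ? ->.
near=> z; rewrite eE.
have -> : a +i* b - z = (a - complex.Re z)%:C + 'i * (b - complex.Im z)%:C.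
  by rewrite [LHS]complexE; case: (z).
apply: (le_lt_trans (ler_normD _ _)); rewrite normrM.
have -> : `|'i| = 1 :> R[i] by rewrite normc_def/= expr0n/= expr1n add0r sqrtr1.
rewrite mul1r !normc_def/= !expr0n/= !addr0 !sqrtr_sqr ltrD// ltcR.
- by near: z; move/cvgrPdist_lt : Fa; apply.
- by near: z; move/cvgrPdist_lt : Fb; apply.
Unshelve. all: by end_near. Qed.

HB.instance Definition _ := Uniform_isComplete.Build C complex_complete.

Definition complex_inner (x y : C) : R[i] := (x : R[i]) * Num.conj (y : R[i]).

Let complex_inner_bilinear :
  bilinear_for *%R (@Num.conj R[i] \; *%R) complex_inner.
Proof.
split=> [y a x x'|x a y y'] /=; rewrite /complex_inner.
  by rewrite mulrDl -mulrA.
by rewrite rmorphD rmorphM mulrDr mulrCA.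
Qed.

HB.instance Definition _ :=
  bilinear_isBilinear.Build _ _ _ _ _ _ complex_inner complex_inner_bilinear.

Let complex_inner_hermitian (x y : C) :
  complex_inner x y = (-1) ^+ false * Num.conj (complex_inner y x).
Proof. by rewrite mul1r rmorphM/= conjCK mulrC. Qed.

HB.instance Definition _ := isHermitianSesquilinear.Build _ _ _ _
  complex_inner complex_inner_hermitian.

Let complex_inner_gt0 (x : C) : x != 0 -> 0 < complex_inner x x.
Proof. by move=> x0; rewrite /complex_inner -normCK exprn_gt0 ?normr_gt0. Qed.

HB.instance Definition _ := isDotProduct.Build _ _ complex_inner complex_inner_gt0.

Let complex_innerE (x : C) : complex_inner x x = `|x| ^+ 2.
Proof. by rewrite normCK. Qed.

HB.instance Definition _ :=
  CompleteNormedModule_isHilbert.Build R C complex_innerE.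

End complex_hilbert.

(* The Hilbert space direct sum of n copies of H. *)
Definition hsum (R : realType) (H : hilbertType R) (n : nat) : Type :=
  {ffun 'I_n -> H}.

Section hsum_hilbert.
Variables (R : realType) (H : hilbertType R) (n : nat).
Local Notation V := (hsum H n).
Implicit Types x y z : V.

HB.instance Definition _ := GRing.Lmodule.copy V {ffun 'I_n -> H}.

Lemma hsumP x y : (forall i, x i = y i) -> x = y.
Proof. by move=> xy; apply/ffunP. Qed.

Lemma hsumDE x y i : (x + y) i = x i + y i.
Proof. exact: ffunE. Qed.

Lemma hsumNE x i : (- x) i = - x i.
Proof. exact: ffunE. Qed.

Lemma hsumZE a x i : (a *: x) i = a *: x i.
Proof. exact: ffunE. Qed.

Definition hsum_inner x y : R[i] := \sum_i inner (x i) (y i).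

Let hsum_inner_bilinear :
  bilinear_for *%R (@Num.conj R[i] \; *%R) hsum_inner.
Proof.
split=> [y a x x'|x a y y'] /=; rewrite /hsum_inner mulr_sumr -big_split/=;
  apply: eq_bigr => i _; rewrite hsumDE hsumZE.
  by rewrite (linearDl inner) (linearZl_LR inner).
by rewrite (linearDr inner) (linearZr_LR inner).
Qed.

HB.instance Definition _ :=
  bilinear_isBilinear.Build _ _ _ _ _ _ hsum_inner hsum_inner_bilinear.

Let hsum_inner_hermitian x y :
  hsum_inner x y = (-1) ^+ false * Num.conj (hsum_inner y x).
Proof.
rewrite mul1r rmorph_sum/=; apply: eq_bigr => i _.
by rewrite [LHS](hermC inner) mul1r.
Qed.

HB.instance Definition _ := isHermitianSesquilinear.Build _ _ _ _
  hsum_inner hsum_inner_hermitian.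

Lemma hsum_innerE x : hsum_inner x x = \sum_i `|x i| ^+ 2.
Proof. by apply: eq_bigr => i _; rewrite innerE. Qed.

Let hsum_inner_gt0 x : x != 0 -> 0 < hsum_inner x x.
Proof.
rewrite hsum_innerE lt_def sumr_ge0// andbT; apply: contraNN.
rewrite psumr_eq0// => /allP/= h; apply/eqP/hsumP => i.
have := h i (mem_index_enum i).
by rewrite /= expf_eq0/= normr_eq0 => /eqP ->; rewrite ffunE.
Qed.

HB.instance Definition _ := isDotProduct.Build _ _ hsum_inner hsum_inner_gt0.

Definition hsum_norm x : R[i] := sqrtC (hsum_inner x x).

Let hsum_normD x y : hsum_norm (x + y) <= hsum_norm x + hsum_norm y.
Proof. exact: dot_triangle. Qed.

Let hsum_normZ a x : hsum_norm (a *: x) = `|a| * hsum_norm x.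
Proof.
rewrite /hsum_norm dnormZ/= sqrtCM ?nnegrE ?exprn_ge0 ?dnorm_ge0//.
by rewrite sqrCK.
Qed.

Let hsum_norm0_eq0 x : hsum_norm x = 0 -> x = 0.
Proof. by move/eqP; rewrite sqrt_dnorm_eq0 => /eqP. Qed.

HB.instance Definition _ := Lmodule_isNormed.Build R[i] V
  hsum_normD hsum_normZ hsum_norm0_eq0.

Lemma hsum_normE x : `|x| ^+ 2 = \sum_i `|x i| ^+ 2.
Proof. by rewrite -hsum_innerE -[RHS]sqrtCK. Qed.

Lemma ler_hsum_coord x i : `|x i| <= `|x|.
Proof.
rewrite -ler_sqr ?nnegrE// hsum_normE (bigD1 i)//= lerDl sumr_ge0//.
Qed.

Lemma ler_hsum_norm x : `|x| <= \sum_i `|x i|.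
Proof.
rewrite -ler_sqr ?nnegrE ?sumr_ge0// hsum_normE.
suff [] : \sum_i `|x i| ^+ 2 <= (\sum_i `|x i|) ^+ 2 /\ 0 <= \sum_i `|x i| by [].
elim/big_rec2: _ => [|i a b _ [ab a0]]; first by rewrite expr0n.
split; last exact: addr_ge0.
by rewrite sqrrD addrAC ler_wpDr ?mulrn_wge0 ?mulr_ge0// lerD2l.
Qed.

Lemma hsum_complete (F : set_system V) : ProperFilter F -> cauchy F -> cvg F.
Proof.
move=> FF Fc.
have lt_n (e : R[i]) : 0 < e -> (e / n.+1%:R) *+ n < e.
  move=> e0; rewrite -mulr_natr mulrAC ltr_pdivrMr ?ltr0n//.
  by rewrite ltr_pM2l// ltr_nat.
have cvgi i : cvg ((fun x : V => x i) @ F).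
  apply: cauchy_cvg; apply/cauchyP => e e0.
  have [x Fx] := (cauchyP F).1 Fc e e0.
  exists (x i); rewrite nbhs_simpl /=; apply: filterS Fx => z /=.
  rewrite -!ball_normE /= => xz; apply: le_lt_trans xz.
  by rewrite -hsumNE -hsumDE; exact: ler_hsum_coord.
have /choice[l Fl] : forall i, exists l : H, (fun x : V => x i) @ F --> l.
  by move=> i; have /cvg_ex[l ?] := cvgi i; exists l.
apply/cvg_ex; exists ([ffun i => l i] : V).
apply/cvgrPdist_lt => e e0.
have e'0 : 0 < e / n.+1%:R by rewrite divr_gt0.
have : \forall x \near F, forall i : 'I_n, `|l i - (x : V) i| < e / n.+1%:R.
  apply: filter_forall => i.
  by move/cvgrPdist_lt : (Fl i); apply.
apply: filterS => x h; apply: le_lt_trans (ler_hsum_norm _) _.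
apply: (@le_lt_trans _ _ (\sum_(i < n) e / n.+1%:R)).
  apply: ler_sum => i _; rewrite hsumDE hsumNE.
  by rewrite [X in X - _](_ : _ = l i) ?ltW//; exact: ffunE.
by rewrite sumr_const card_ord; exact: lt_n.
Qed.

HB.instance Definition _ := Uniform_isComplete.Build V hsum_complete.

Let hsum_inner_norm x : hsum_inner x x = `|x| ^+ 2.
Proof. by rewrite hsum_normE hsum_innerE. Qed.

HB.instance Definition _ :=
  CompleteNormedModule_isHilbert.Build R V hsum_inner_norm.

End hsum_hilbert.

Record bounded_op (R : realType) (H : hilbertType R) : Type := BoundedOp {
  bop_fun :> H -> H ;
  bop_linear : linear bop_fun ;
  bop_bounded : exists M : R, forall x, rnorm (bop_fun x) <= M * rnorm x
}.

Section bounded_op_algebra.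
Variables (R : realType) (H : hilbertType R).
Local Notation B := (bounded_op H).
Implicit Types S T U : B.

Lemma bopP S T : S =1 T -> S = T.
Proof.
case: S T => [f fl fb] [g gl gb] /= /funext fg; move: fl fb gl gb; rewrite fg.
by move=> fl fb gl gb; congr BoundedOp; exact: Prop_irrelevance.
Qed.

HB.instance Definition _ T := GRing.isLinear.Build R[i] H H _ T (bop_linear T).

Lemma bop_bounded_ge0 T :
  exists2 M : R, 0 <= M & forall x, rnorm (T x) <= M * rnorm x.
Proof.
have [M TM] := bop_bounded T; exists `|M| => // x.
by apply: le_trans (TM x) _; rewrite ler_wpM2r ?rnorm_ge0 ?ler_norm.
Qed.

Let zero_linear : linear (fun _ : H => 0 : H).
Proof. by move=> a x y; rewrite scaler0 addr0. Qed.

Let zero_bounded :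
  exists M : R, forall x : H, rnorm (0 : H) <= M * rnorm x.
Proof. by exists 0 => x; rewrite rnorm0 mul0r. Qed.

Definition bop_zero : B := BoundedOp zero_linear zero_bounded.

Let one_linear : linear (@id H).
Proof. by []. Qed.

Let one_bounded : exists M : R, forall x : H, rnorm (id x) <= M * rnorm x.
Proof. by exists 1 => x; rewrite mul1r. Qed.

Definition bop_one : B := BoundedOp one_linear one_bounded.

Let opp_linear T : linear (fun x => - T x).
Proof. by move=> a x y; rewrite linearP opprD scalerN. Qed.

Let opp_bounded T : exists M : R, forall x, rnorm (- T x) <= M * rnorm x.
Proof.
by have [M TM] := bop_bounded T; exists M => x; rewrite /rnorm normrN; exact: TM.
Qed.

Definition bop_opp T : B := BoundedOp (opp_linear T) (opp_bounded T).

Let add_linear S T : linear (fun x => S x + T x).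
Proof. by move=> a x y; rewrite !linearP scalerDr addrACA. Qed.

Let add_bounded S T : exists M : R, forall x, rnorm (S x + T x) <= M * rnorm x.
Proof.
have [[M SM] [N TN]] := (bop_bounded S, bop_bounded T).
exists (M + N) => x; apply: le_trans (ler_rnormD _ _) _.
by rewrite mulrDl lerD.
Qed.

Definition bop_add S T : B := BoundedOp (add_linear S T) (add_bounded S T).

Let mul_linear S T : linear (fun x => S (T x)).
Proof. by move=> a x y; rewrite !linearP. Qed.

Let mul_bounded S T : exists M : R, forall x, rnorm (S (T x)) <= M * rnorm x.
Proof.
have [[M M0 SM] [N TN]] := (bop_bounded_ge0 S, bop_bounded T).
exists (M * N) => x; apply: le_trans (SM _) _.
by rewrite -mulrA ler_wpM2l.
Qed.

Definition bop_mul S T : B := BoundedOp (mul_linear S T) (mul_bounded S T).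

Let scale_linear (a : R[i]) T : linear (fun x => a *: T x).
Proof.
by move=> b x y; rewrite linearP scalerDr !scalerA mulrC.
Qed.

Let scale_bounded (a : R[i]) T :
  exists M : R, forall x, rnorm (a *: T x) <= M * rnorm x.
Proof.
have [M TM] := bop_bounded T; exists (rnorm a * M) => x.
by rewrite rnormZ -mulrA ler_wpM2l ?rnorm_ge0.
Qed.

Definition bop_scale (a : R[i]) T : B :=
  BoundedOp (scale_linear a T) (scale_bounded a T).

HB.instance Definition _ := gen_eqMixin B.
HB.instance Definition _ := gen_choiceMixin B.

Let addA : associative bop_add.
Proof. by move=> S T U; apply: bopP => x /=; rewrite addrA. Qed.
Let addC : commutative bop_add.
Proof. by move=> S T; apply: bopP => x /=; rewrite addrC. Qed.
Let add0 : left_id bop_zero bop_add.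
Proof. by move=> S; apply: bopP => x /=; rewrite add0r. Qed.
Let addN : left_inverse bop_zero bop_opp bop_add.
Proof. by move=> S; apply: bopP => x /=; rewrite addNr. Qed.

HB.instance Definition _ := GRing.isZmodule.Build B addA addC add0 addN.

Let mulA : associative bop_mul.
Proof. by move=> S T U; apply: bopP. Qed.
Let mul1 : left_id bop_one bop_mul.
Proof. by move=> S; apply: bopP. Qed.
Let mulo1 : right_id bop_one bop_mul.
Proof. by move=> S; apply: bopP. Qed.
Let mulDl : left_distributive bop_mul bop_add.
Proof. by move=> S T U; apply: bopP. Qed.
Let mulDr : right_distributive bop_mul bop_add.
Proof. by move=> S T U; apply: bopP => x /=; rewrite linearD. Qed.

HB.instance Definition _ :=
  GRing.Zmodule_isPzRing.Build B mulA mul1 mulo1 mulDl mulDr.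

Let scaleA a b T : bop_scale a (bop_scale b T) = bop_scale (a * b) T.
Proof. by apply: bopP => x /=; rewrite scalerA. Qed.
Let scale1 : left_id 1 bop_scale.
Proof. by move=> T; apply: bopP => x /=; rewrite scale1r. Qed.
Let scaleDr : right_distributive bop_scale +%R.
Proof. by move=> a S T; apply: bopP => x /=; rewrite scalerDr. Qed.
Let scaleDl T : {morph bop_scale^~ T : a b / a + b}.
Proof. by move=> a b; apply: bopP => x /=; rewrite scalerDl. Qed.

HB.instance Definition _ :=
  GRing.Zmodule_isLmodule.Build R[i] B scaleA scale1 scaleDr scaleDl.

End bounded_op_algebra.

Section operator_theory.
Variables (R : realType) (H : hilbertType R).
Implicit Types (A T : bounded_op H) (f : R -> R).

Definition opnorm T : R := sup [set rnorm (T x) | x in [set x | rnorm x <= 1]].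

(* By the Riesz representation theorem the relation below determines exactly
   one operator, so the default value 0 is never used. *)
Definition adjoint T : bounded_op H :=
  xget 0 [set S : bounded_op H | forall x y, inner (T x) y = inner x (S y)].

Definition bop_invertible T : Prop :=
  exists S : bounded_op H, S * T = 1 /\ T * S = 1.

Definition spectrum A : set R[i] :=
  [set z : R[i] | ~ bop_invertible (z *: (1 : bounded_op H) - A)].

Definition real_spectrum A : set R := [set t | spectrum A t%:C].

Definition opoly (p : {poly R}) A : bounded_op H :=
  \sum_(i < size p) (p`_i)%:C *: A ^+ i.

(* Continuous functional calculus of a self-adjoint operator A: f(A) is the
   norm limit of p_k(A), for any real polynomials p_k converging to f uniformly
   on the spectrum of A (which is real and compact). For f continuous on the
   spectrum such p_k exist by Weierstrass, and the limit does not depend on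
   them; thus f only matters on the spectrum, and xget picks the only value. *)
Definition is_cfc f A (B : bounded_op H) : Prop :=
  exists2 p : nat -> {poly R},
    {uniform real_spectrum A, (fun k t => (p k).[t]) @ \oo --> f} &
    opnorm (opoly (p k) A - B) @[k --> \oo] --> (0 : R).

Definition cfc f A : bounded_op H := xget 0 (is_cfc f A).

Definition absop T : bounded_op H := cfc (@Num.sqrt R) (adjoint T * T).

Definition alpha_norm (alpha : R) T : R :=
  sup [set Num.sqrt (alpha * rnorm (inner (T x) x) ^+ 2
                     + (1 - alpha) * rnorm (T x) ^+ 2)
      | x in [set x | rnorm x = 1]].

End operator_theory.

Section operator_matrix.
Variables (R : realType) (H : hilbertType R) (n : nat).
Variable T : 'M[bounded_op H]_n.

Definition opmx_fun (x : hsum H n) : hsum H n := [ffun i => \sum_j T i j (x j)].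

Let opmx_linear : linear opmx_fun.
Proof.
move=> a x y; apply: hsumP => i; rewrite hsumDE hsumZE !ffunE.
rewrite scaler_sumr -big_split/=; apply: eq_bigr => j _.
by rewrite hsumDE hsumZE linearP.
Qed.

Let opmx_bounded :
  exists M : R, forall x, rnorm (opmx_fun x) <= M * rnorm x.
Proof.
have /choice[M MT] : forall ij : 'I_n * 'I_n, exists M : R,
    0 <= M /\ forall x, rnorm (T ij.1 ij.2 x) <= M * rnorm x.
  by move=> ij; have [M M0 TM] := bop_bounded_ge0 (T ij.1 ij.2); exists M.
exists (\sum_i \sum_j M (i, j)) => x.
apply: (@le_trans _ _ (\sum_i rnorm (opmx_fun x i))).
  rewrite -lecR rnormE rmorph_sum/= (eq_bigr (fun i => `|opmx_fun x i|)).
    exact: ler_hsum_norm.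
  by move=> i _; rewrite rnormE.
rewrite mulr_suml; apply: ler_sum => i _; rewrite ffunE mulr_suml.
apply: le_trans (ler_rnorm_sum _ _) _; apply: ler_sum => j _.
have [M0 TM] := MT (i, j).
apply: le_trans (TM _) _; rewrite ler_wpM2l//.
by rewrite -lecR !rnormE; exact: ler_hsum_coord.
Qed.

Definition opmx : bounded_op (hsum H n) := BoundedOp opmx_linear opmx_bounded.

End operator_matrix.

(* A real matrix acting on C^n = hsum (cline R) n by x |-> A x: the entry c acts
   on C as c *: 1. *)
Definition scalar_opmx (R : realType) (n : nat) (A : 'M[R]_n) :
    bounded_op (hsum (cline R) n) :=
  opmx (map_mx (fun c : R => c%:C *: (1 : bounded_op (cline R))) A).

(* Main.v *)
Require Import Defs.
From HB Require Import structures.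
From mathcomp Require Import all_boot all_order all_algebra.
From mathcomp Require Import sesquilinear complex ring lra.
From mathcomp Require Import all_classical all_reals all_analysis.

Set Implicit Arguments.
Unset Strict Implicit.
Unset Printing Implicit Defensive.

Import Order.TTheory GRing.Theory Num.Theory.
Import numFieldNormedType.Exports.
Local Open Scope classical_set_scope.
Local Open Scope ring_scope.
Local Open Scope complex_scope.

(** Write [u] for the vector of the norms of the blocks of a unit vector [x] of
    the direct sum, which is a unit vector of the scalar space.  The proof
    compares the quantities [ |<T x, x>| ] and [ |T x| ] defining the
    alpha-norm with [ |R u| ] and [ |S u| ], and then passes to the power [p].

    The second comparison is the triangle inequality in each row.  The first
    rests on the mixed Schwarz inequality ([mixed_schwarz])
    [ |<A y, z>| <= |f(|A|) y| |g(|A^*|) z| ] for a bounded operator [A]: used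
    for the entries of [T] it bounds [ |<T x, x>| ] by a bilinear expression in
    the coordinates of [u], whose symmetrised matrix is [R].

    Young's inequality says that [t `^ p] lies above each of its tangent lines.
    By functional calculus this yields, for a matrix [M], a lower bound for
    [< |M|^(2p) u, u >] that is affine in [ |M u|^2 ]
    ([cfc_mccarthy_tangent]).  The tangent at the point
    [w = alpha |R u|^2 + (1 - alpha) |S u|^2], used for both matrices, gives
    [w `^ p <= <(alpha |R|^(2p) + (1 - alpha) |S|^(2p)) u, u>], and the right
    side is at most the operator norm; convexity in [alpha] and the inequality
    of McCarthy are obtained in this single step ([alpha_norm_powR_le]).

    The mixed Schwarz inequality is proved without a polar decomposition.  Since
    [A] intertwines [A^* A] and [A A^*], also [A h(|A|) = h(|A^*|) A] for
    continuous [h] ([cfc_intertwine]).  If [f] has no zero, [A = C f(|A|)] with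
    [C = A f(|A|)^-1] and [C C^* = |A^*|^2 f(|A^*|)^-2 = g(|A^*|)^2], so that
    [ |C^* z| = |g(|A^*|) z| ]; in general [1 / f] is replaced by
    [f / (f^2 + d^2)] and [d] tends to 0.

    All of this requires the continuous functional calculus to exist and to be
    multiplicative, positive and unique.  Its core is that a real polynomial
    which is non-negative on the spectrum of a self-adjoint operator gives a
    positive operator ([opoly_pos]): the infimum of a self-adjoint numerical
    range belongs to the spectrum ([numrange_inf_spectrum]), and factoring the
    polynomial over the complex numbers transports it to a value of the
    polynomial on the spectrum.  Invertibility of coercive operators and
    existence of adjoints both come from minimising a quadratic functional
    ([coercive_representation]); density of polynomials comes from Bernstein
    polynomials ([weierstrass_approximation]). *)

(** * Real inner product and operator norm *)

Section inner_product.
Variables (R : realType) (H : hilbertType R).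
Implicit Types x y z : H.

Definition rinner x y : R := complex.Re (inner x y).

Lemma inner_conj x y : inner x y = (inner y x)^*%C.
Proof. by rewrite [LHS](hermC inner) mul1r. Qed.

Lemma inner_normE x : inner x x = (rnorm x ^+ 2)%:C.
Proof. by rewrite innerE -rnormE rmorphXn. Qed.

Lemma rinner_normE x : rinner x x = rnorm x ^+ 2.
Proof. by rewrite /rinner inner_normE. Qed.

Lemma rinnerC x y : rinner x y = rinner y x.
Proof. by rewrite /rinner inner_conj; case: (inner y x). Qed.

Lemma rinnerDl x y z : rinner (x + y) z = rinner x z + rinner y z.
Proof. by rewrite /rinner (linearDl inner) raddfD. Qed.

Lemma rinnerDr x y z : rinner z (x + y) = rinner z x + rinner z y.
Proof. by rewrite !(rinnerC z) rinnerDl. Qed.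

Lemma Re_mul_real (a : R) (z : R[i]) : complex.Re (a%:C * z) = a * complex.Re z.
Proof. by case: z => u v /=; rewrite mul0r subr0. Qed.

Lemma rinnerZl (a : R) x y : rinner (a%:C *: x) y = a * rinner x y.
Proof. by rewrite /rinner (linearZl_LR inner) /= Re_mul_real. Qed.

Lemma rinnerZr (a : R) x y : rinner x (a%:C *: y) = a * rinner x y.
Proof. by rewrite !(rinnerC x) rinnerZl. Qed.

Lemma rinnerNl x y : rinner (- x) y = - rinner x y.
Proof. by rewrite /rinner (linearNl inner) raddfN. Qed.

Lemma rinnerNr x y : rinner y (- x) = - rinner y x.
Proof. by rewrite !(rinnerC y) rinnerNl. Qed.

Lemma rinnerBl x y z : rinner (x - y) z = rinner x z - rinner y z.
Proof. by rewrite rinnerDl rinnerNl. Qed.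

Lemma rinnerBr x y z : rinner z (x - y) = rinner z x - rinner z y.
Proof. by rewrite rinnerDr rinnerNr. Qed.

Lemma rinner0l x : rinner 0 x = 0.
Proof. by rewrite /rinner (linear0l inner). Qed.

Lemma rnorm_scalar_ge_Re (z : R[i]) : `|complex.Re z| <= rnorm z.
Proof. by rewrite -lecR rnormE; exact: normc_ge_Re. Qed.

Lemma ler_inner x y : rnorm (inner x y) <= rnorm x * rnorm y.
Proof.
rewrite -ler_sqr ?nnegrE ?mulr_ge0 ?rnorm_ge0// -lecR.
rewrite rmorphXn/= rnormE exprMn rmorphM/= -!inner_normE.
exact: dot_CauchySchwarz.
Qed.

Lemma ler_rinner x y : `|rinner x y| <= rnorm x * rnorm y.
Proof. exact: le_trans (rnorm_scalar_ge_Re _) (ler_inner _ _). Qed.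

Lemma rnorm_eq0 x : rnorm x = 0 -> x = 0.
Proof. by move=> h; apply/eqP; rewrite -normr_eq0 -rnormE h. Qed.

Lemma rnormN x : rnorm (- x) = rnorm x.
Proof. by rewrite /rnorm normrN. Qed.

Lemma rnormB x y : rnorm (x - y) = rnorm (y - x).
Proof. by rewrite -rnormN opprB. Qed.

Lemma rnormZr (a : R) x : rnorm (a%:C *: x) = `|a| * rnorm x.
Proof.
rewrite rnormZ; congr (_ * _); apply: complexI.
by rewrite rnormE normc_def /= expr0n addr0 sqrtr_sqr.
Qed.

(** The imaginary part is recovered by multiplying with ['i]; this lets the
    arguments below work with the real inner product only. *)
Lemma complex_Re_inj (phi psi : R[i]) :
  complex.Re phi = complex.Re psi ->
  complex.Re ('i * phi) = complex.Re ('i * psi) -> phi = psi.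
Proof.
case: phi psi => a b [c d] /= -> ; rewrite !mul0r !sub0r !mul1r => /oppr_inj ->.
by [].
Qed.

Lemma rnorm_cauchy_cvg (u : nat -> H) :
  (forall e : R, 0 < e -> exists N, forall m n, (N <= m)%N -> (N <= n)%N ->
     rnorm (u m - u n) <= e) ->
  exists l, forall e : R, 0 < e -> exists N, forall n, (N <= n)%N ->
     rnorm (u n - l) <= e.
Proof.
move=> uC.
have Cu : cauchy (u @ \oo).
  apply/cauchyP => e; rewrite ltcE => /andP[/eqP/= ei e0].
  have [N hN] := uC (complex.Re e / 2) (divr_gt0 e0 (ltr0n _ 2)).
  exists (u N); exists N => // n /= Nn.
  rewrite -ball_normE/= -rnormE.
  have -> : e = (complex.Re e)%:C by case: (e) ei => ? ? /= ->.
  rewrite ltcR; apply: le_lt_trans (hN _ _ (leqnn N) Nn) _.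
  by rewrite ltr_pdivrMr// ltr_pMr// ltr1n.
have ul : u @ \oo --> lim (u @ \oo) by exact: (@cauchy_cvg H _ _ Cu).
exists (lim (u @ \oo)) => e e0.
have /(_ e%:C) : forall e, 0 < e -> \forall n \near \oo, `|lim (u @ \oo) - u n| < e.
  by move/cvgrPdist_lt : ul.
rewrite ltcR => /(_ e0)[N _ hN]; exists N => n Nn.
by have := hN n Nn; rewrite -rnormE ltcR rnormB => /ltW.
Qed.

End inner_product.

Section opnorm_theory.
Variables (R : realType) (H : hilbertType R).
Implicit Types (S T : bounded_op H) (x y : H).

Lemma opnorm_ubound T x : rnorm x <= 1 -> rnorm (T x) <= opnorm T.
Proof.
move=> x1; apply: ub_le_sup; last by exists x.
have [M M0 TM] := bop_bounded_ge0 T.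
exists M => _ [y /= y1 <-]; apply: le_trans (TM y) _.
by rewrite ler_piMr.
Qed.

Lemma opnorm_ge0 T : 0 <= opnorm T.
Proof.
apply: le_trans (rnorm_ge0 (T 0)) _; apply: opnorm_ubound.
by rewrite rnorm0.
Qed.

Lemma ler_opnorm T x : rnorm (T x) <= opnorm T * rnorm x.
Proof.
have [x0|x0] := eqVneq (rnorm x) 0.
  by rewrite (rnorm_eq0 x0) linear0 rnorm0 mulr0.
have xp : 0 < rnorm x by rewrite lt_def x0 rnorm_ge0.
have := @opnorm_ubound T ((rnorm x)^-1%:C *: x).
rewrite linearZ/= !rnormZr ger0_norm ?invr_ge0 ?rnorm_ge0//.
by rewrite mulVf// => /(_ (lexx _)); rewrite mulrC ler_pdivrMr.
Qed.

Lemma opnorm_le T (c : R) : 0 <= c ->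
  (forall x, rnorm (T x) <= c * rnorm x) -> opnorm T <= c.
Proof.
move=> c0 Tc; apply: ge_sup; first by exists (rnorm (T 0)), 0; rewrite //= rnorm0.
by move=> _ [x /= x1 <-]; apply: le_trans (Tc x) _; rewrite ler_piMr.
Qed.

Lemma opnormD S T : opnorm (S + T) <= opnorm S + opnorm T.
Proof.
apply: opnorm_le => [|x]; first by rewrite addr_ge0 ?opnorm_ge0.
rewrite mulrDl; apply: le_trans (ler_rnormD _ _) _.
by rewrite lerD// ler_opnorm.
Qed.

Lemma opnormM S T : opnorm (S * T) <= opnorm S * opnorm T.
Proof.
apply: opnorm_le => [|x]; first by rewrite mulr_ge0 ?opnorm_ge0.
apply: le_trans (ler_opnorm S _) _.
by rewrite -mulrA ler_wpM2l ?opnorm_ge0 ?ler_opnorm.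
Qed.

Lemma opnormN T : opnorm (- T) = opnorm T.
Proof.
suff h (U : bounded_op H) : opnorm (- U) <= opnorm U.
  by apply/eqP; rewrite eq_le h -{1}(opprK T) h.
apply: opnorm_le => [|x]; first exact: opnorm_ge0.
by rewrite rnormN ler_opnorm.
Qed.

Lemma opnorm_le_eq0 T : opnorm T <= 0 -> T = 0.
Proof.
move=> T0; apply: bopP => x; apply: (@rnorm_eq0 _ H); apply/eqP.
rewrite eq_le rnorm_ge0 andbT; apply: le_trans (ler_opnorm _ _) _.
by rewrite mulr_le0_ge0 ?rnorm_ge0.
Qed.

End opnorm_theory.

(** * Riesz representation, adjoints, coercive operators *)

Section riesz.
Variables (R : realType) (H : hilbertType R).
Implicit Types (x y z : H) (T P : bounded_op H).

Lemma invS_le (e : R) : 0 < e -> exists N, forall n, (N <= n)%N -> n.+1%:R^-1 <= e.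
Proof.
move=> e0; exists (Num.truncn e^-1) => n Nn.
rewrite invf_ple ?posrE//; apply: ltW; apply: lt_le_trans (truncnS_gt _) _.
by rewrite ler_nat ltnS.
Qed.

(** Minimise [J x = <P x, x> - 2 phi x].  Coercivity bounds [J] below and, by the
    parallelogram identity, makes minimising sequences Cauchy; the first
    variation of [J] vanishes at the limit.  With [P] the identity this is the
    Riesz representation theorem, with [phi] an inner product it solves
    [P z = y]. *)
Lemma coercive_representation (P : {linear H -> H}) (c : R) (phi : H -> R) (M : R) :
  0 < c ->
  (forall x y, rinner (P x) y = rinner x (P y)) ->
  (forall x, c * rnorm x ^+ 2 <= rinner (P x) x) ->
  (forall x y, phi (x + y) = phi x + phi y) ->
  (forall (a : R) x, phi (a%:C *: x) = a * phi x) ->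
  (forall x, `|phi x| <= M * rnorm x) ->
  exists z, forall x, phi x = rinner x (P z).
Proof.
move=> c0 Psym Pge phiD phiZ phiM.
pose J x := rinner (P x) x - 2 * phi x.
have JE x h t : J (x + t%:C *: h) =
    J x + 2 * t * (rinner x (P h) - phi h) + t ^+ 2 * rinner (P h) h.
  rewrite /J phiD phiZ linearD linearZ/= !rinnerDl !rinnerDr !rinnerZl !rinnerZr.
  by rewrite (Psym x h) (rinnerC (P h) x); ring.
have Jlb : has_inf (range J).
  split; first by exists (J 0), 0.
  exists (- (M ^+ 2 / c)) => _ [x _ <-].
  rewrite -subr_ge0 opprK; have := Pge x; have := phiM x.
  rewrite /J ler_norml => /andP[_ h1] h2.
  apply: (@le_trans _ _ ((c * rnorm x - M) ^+ 2 / c)).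
    by rewrite divr_ge0 ?sqr_ge0 ?ltW.
  have -> : (c * rnorm x - M) ^+ 2 / c =
    c * rnorm x ^+ 2 - 2 * (M * rnorm x) + M ^+ 2 / c.
    by field; rewrite gt_eqF.
  lra.
set I := inf (range J).
have Jge x : I <= J x by apply: (ge_inf Jlb.2); exists x.
have /choice[u uJ] : forall n : nat, exists x, J x < I + n.+1%:R^-1.
  move=> n; have n0 : 0 < n.+1%:R^-1 :> R by rewrite invr_gt0 ltr0n.
  have [_ [x _ <-] h] := inf_adherent n0 Jlb.
  by exists x.
have Jconv x y : c / 2 * rnorm (x - y) ^+ 2 <= J x + J y - 2 * I.
  have := Jge (x + (2^-1)%:C *: (y - x)).
  have := JE x (y - x) 1; rewrite scale1r [x + _]addrC subrK => ->.
  rewrite JE; have := Pge (y - x); rewrite rnormB.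
  set q := rinner (P _) _; set l := rinner x _ - _; set r := rnorm _ ^+ 2 => h1 h2.
  lra.
(* Any minimising sequence converges. *)
have [z uz] : exists l, forall e : R, 0 < e -> exists N, forall n, (N <= n)%N ->
     rnorm (u n - l) <= e.
  apply: rnorm_cauchy_cvg => e e0.
  have [|N hN] := @invS_le (c * e ^+ 2 / 4).
    by rewrite divr_gt0// mulr_gt0// exprn_gt0.
  exists N => m n Nm Nn.
  rewrite -ler_sqr ?nnegrE ?rnorm_ge0 ?(ltW e0)//.
  have c20 : 0 < c / 2 by rewrite divr_gt0.
  rewrite -(ler_pM2l c20).
  have := Jconv (u m) (u n); have := uJ m; have := uJ n.
  have := hN _ Nm; have := hN _ Nn.
  move: (_ ^+ 2) (e ^+ 2) (m.+1%:R^-1) (n.+1%:R^-1) => a b d f; lra.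
exists z => h; apply/eqP; rewrite eq_sym -subr_eq0 (rinnerC h) Psym.
set Q := rinner (P h) h; set L := _ - _.
have Q0 : 0 <= Q by apply: le_trans (Pge h); rewrite mulr_ge0 ?(ltW c0) ?sqr_ge0.
(* The limit of [inf J <= J (u n + t h)]: by symmetry of [P], its linear term
   depends on [u n] through the inner product with the fixed vector [P h]. *)
have LQ t : 0 <= 2 * t * L + t ^+ 2 * Q.
  apply/ler_addgt0Pr => e e0; have e20 : 0 < e / 2 by rewrite divr_gt0.
  pose K := 2 * `|t| * rnorm (P h) + 1.
  have K0 : 0 < K by rewrite ltr_wpDl// !mulr_ge0 ?rnorm_ge0.
  have [N hN] := invS_le e20.
  have [N' hN'] := uz (e / 2 / K) (divr_gt0 e20 K0).
  pose n := maxn N N'.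
  have h1 := hN n (leq_maxl _ _); have h2 := hN' n (leq_maxr _ _).
  have := Jge (u n + t%:C *: h); rewrite JE -/Q.
  have -> : rinner (u n) (P h) - phi h = L + rinner (u n - z) (P h).
    by rewrite rinnerBl /L; ring.
  have h3 := uJ n.
  have h4 : 2 * t * rinner (u n - z) (P h) <= e / 2.
    apply: le_trans (ler_norm _) _; rewrite !normrM ger0_norm//.
    apply: (@le_trans _ _ (rnorm (u n - z) * K)); last first.
      by rewrite -ler_pdivlMr.
    apply: (@le_trans _ _ (2 * `|t| * (rnorm (u n - z) * rnorm (P h)))).
      by rewrite ler_wpM2l ?mulr_ge0 ?ler_rinner.
    rewrite mulrCA ler_wpM2l ?rnorm_ge0// /K; lra.
  move: h3 h4 h1 => {hN hN' h2 uJ}; set q := (_.+1%:R^-1).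
  lra.
(* This [t] makes the right side negative unless [L] vanishes; the minimiser
   [- L / Q] of the quadratic is avoided because [Q] may be 0. *)
have := LQ (- (L / (Q + 1))).
have Q1 : 0 < Q + 1 by rewrite ltr_wpDl.
have -> : 2 * - (L / (Q + 1)) * L + (- (L / (Q + 1))) ^+ 2 * Q =
   - (L ^+ 2 * ((Q + 2) / (Q + 1) ^+ 2)) by field; rewrite gt_eqF.
rewrite oppr_ge0 pmulr_lle0; last by rewrite divr_gt0 ?exprn_gt0// ltr_wpDl.
by move=> L0; rewrite -sqrf_eq0 eq_le L0 sqr_ge0.
Qed.

Lemma rinner_inj x y : (forall z, rinner z x = rinner z y) -> x = y.
Proof.
move=> h; apply/eqP; rewrite -subr_eq0; apply/eqP/rnorm_eq0/eqP.
by rewrite -sqrf_eq0 -rinner_normE rinnerBr h subrr.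
Qed.

Lemma inner_of_rinner (u v x y : H) :
  rinner u v = rinner x y -> rinner ('i *: u) v = rinner ('i *: x) y ->
  inner u v = inner x y.
Proof.
move=> h1 h2; apply: complex_Re_inj; first exact: h1.
by move: h2; rewrite /rinner !(linearZl_LR inner).
Qed.

Lemma inner_inj x y : (forall z, inner z x = inner z y) -> x = y.
Proof. by move=> h; apply: rinner_inj => z; rewrite /rinner h. Qed.

Lemma adjoint_exists T :
  exists S : bounded_op H, forall x y, inner (T x) y = inner x (S y).
Proof.
have /choice[S TS] : forall y, exists z, forall x, inner (T x) y = inner x z.
  move=> y.
  have [] := @coercive_representation (idfun : {linear H -> H}) 1
    (fun x => rinner (T x) y) (opnorm T * rnorm y) ltr01 => //.
  - by move=> x; rewrite mul1r rinner_normE.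
  - by move=> a b; rewrite linearD rinnerDl.
  - by move=> a x; rewrite linearZ/= rinnerZl.
  - move=> x; apply: le_trans (ler_rinner _ _) _.
    by rewrite mulrAC ler_wpM2r ?rnorm_ge0// ler_opnorm.
  move=> z zE; exists z => x; apply: inner_of_rinner; first exact: zE.
  by rewrite -linearZ zE.
have Slin : linear S.
  move=> a x y; apply: inner_inj => z.
  by rewrite -TS !(linearDr inner) !(linearZr_LR inner)/= !TS.
have Sbd : exists M, forall x, rnorm (S x) <= M * rnorm x.
  exists (opnorm T) => x.
  have [->|S0] := eqVneq (rnorm (S x)) 0.
    by rewrite mulr_ge0 ?opnorm_ge0 ?rnorm_ge0.
  have Sp : 0 < rnorm (S x) by rewrite lt_def S0 rnorm_ge0.
  rewrite -(ler_pM2l Sp) -expr2 -rinner_normE.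
  have -> : rinner (S x) (S x) = rinner (T (S x)) x by rewrite /rinner TS.
  apply: le_trans (ler_norm _) _; apply: le_trans (ler_rinner _ _) _.
  by rewrite mulrA ler_wpM2r ?rnorm_ge0// mulrC ler_opnorm.
by exists (BoundedOp Slin Sbd) => x y; exact: TS.
Qed.

Lemma adjointP T x y : inner (T x) y = inner x (adjoint T y).
Proof.
have [S TS] := adjoint_exists T.
rewrite /adjoint; case: xgetP => [A _ /(_ x y) -> //|/(_ S)].
by move=> nTS; exfalso; apply: nTS.
Qed.

Lemma adjoint_unique T (S : bounded_op H) :
  (forall x y, inner (T x) y = inner x (S y)) -> adjoint T = S.
Proof.
move=> TS; apply: bopP => y; apply: inner_inj => x.
by rewrite -adjointP TS.
Qed.

Lemma adjointPr T x y : inner (adjoint T x) y = inner x (T y).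
Proof. by rewrite inner_conj -adjointP -inner_conj. Qed.

Lemma adjointK T : adjoint (adjoint T) = T.
Proof. by apply: adjoint_unique => x y; exact: adjointPr. Qed.

Definition selfadj T := forall x y, inner (T x) y = inner x (T y).

Lemma selfadj_rinner T : selfadj T -> forall x y, rinner (T x) y = rinner x (T y).
Proof. by move=> sT x y; rewrite /rinner sT. Qed.

Lemma selfadj_adjointM T : selfadj (adjoint T * T).
Proof. by move=> x y /=; rewrite adjointPr adjointP. Qed.

(** Solvability is [coercive_representation]; the inverse is bounded because
    [c |x| <= |P x|]. *)
Lemma coercive_invertible P (c : R) : 0 < c -> selfadj P ->
  (forall x, c * rnorm x ^+ 2 <= rinner (P x) x) -> bop_invertible P.
Proof.
move=> c0 sP Pge.
have /choice[S PS] : forall y, exists z, P z = y.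
  move=> y.
  have [] := @coercive_representation P c (fun x => rinner x y) (rnorm y) c0 => //.
  - exact: selfadj_rinner.
  - by move=> a b; rewrite rinnerDl.
  - by move=> a x; rewrite rinnerZl.
  - by move=> x; rewrite mulrC ler_rinner.
  by move=> z zE; exists z; apply: rinner_inj => x; rewrite zE.
have Pbelow x : c * rnorm x <= rnorm (P x).
  have [->|x0] := eqVneq (rnorm x) 0; first by rewrite mulr0 rnorm_ge0.
  have xp : 0 < rnorm x by rewrite lt_def x0 rnorm_ge0.
  rewrite -(ler_pM2r xp) -mulrA -expr2; apply: le_trans (Pge x) _.
  exact: le_trans (ler_norm _) (ler_rinner _ _).
have Pinj x y : P x = P y -> x = y.
  move=> xy; apply/eqP; rewrite -subr_eq0; apply/eqP/rnorm_eq0/eqP.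
  rewrite eq_le rnorm_ge0 andbT -(pmulr_rle0 _ c0); apply: le_trans (Pbelow _) _.
  by rewrite linearB/= xy subrr rnorm0.
have Slin : linear S by move=> a x y; apply: Pinj; rewrite linearP/= !PS.
have Sbd : exists M, forall x, rnorm (S x) <= M * rnorm x.
  exists c^-1 => x; rewrite mulrC ler_pdivlMr// mulrC -[in leRHS](PS x).
  exact: Pbelow.
exists (BoundedOp Slin Sbd); split; apply: bopP => x /=; last exact: PS.
by apply: Pinj; rewrite PS.
Qed.

End riesz.

(** * Polynomials of an operator and positivity on the spectrum *)

Section polynomial_calculus.
Variables (R : realType) (H : hilbertType R).
Implicit Types (A S T : bounded_op H) (p q : {poly R}) (P Q : {poly R[i]}).

Lemma bop_scalerAl (a : R[i]) S T : a *: S * T = a *: (S * T).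
Proof. exact: bopP. Qed.

Lemma bop_scalerAr (a : R[i]) S T : S * (a *: T) = a *: (S * T).
Proof. by apply: bopP => x /=; rewrite linearZ. Qed.

(** Factoring a real polynomial into linear factors takes place over the
    complex numbers. *)
Definition cpoly P A : bounded_op H := \sum_(i < size P) P`_i *: A ^+ i.

Lemma opolyE p A : opoly p A = cpoly (map_poly (real_complex R) p) A.
Proof.
rewrite /cpoly size_map_poly; apply: eq_bigr => i _; by rewrite coef_map.
Qed.

Lemma cpoly_widen n P A : (size P <= n)%N -> cpoly P A = \sum_(i < n) P`_i *: A ^+ i.
Proof.
move=> Pn; rewrite /cpoly -(big_mkord xpredT (fun i => P`_i *: A ^+ i)).
rewrite -(big_mkord xpredT (fun i => P`_i *: A ^+ i)).
rewrite (big_cat_nat (leq0n _) Pn)/= [X in _ = _ + X]big_nat_cond.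
rewrite [X in _ = _ + X]big1 ?addr0// => i.
by rewrite andbT => /andP[Pi _]; rewrite nth_default// scale0r.
Qed.

Lemma cpolyD P Q A : cpoly (P + Q) A = cpoly P A + cpoly Q A.
Proof.
pose n := maxn (size P) (size Q).
rewrite !(@cpoly_widen n) ?leq_maxl ?leq_maxr ?(leq_trans (size_polyD _ _))//.
by rewrite -big_split/=; apply: eq_bigr => i _; rewrite coefD scalerDl.
Qed.

Lemma cpolyZ (a : R[i]) P A : cpoly (a *: P) A = a *: cpoly P A.
Proof.
rewrite !(@cpoly_widen (size P)) ?size_scale_leq// scaler_sumr.
by apply: eq_bigr => i _; rewrite coefZ scalerA.
Qed.

Lemma cpolyC (a : R[i]) A : cpoly a%:P A = a *: (1 : bounded_op H).
Proof.
by rewrite (@cpoly_widen 1%N) ?size_polyC_leq1// big_ord1 coefC eqxx expr0.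
Qed.

Lemma cpolyMX P A : cpoly (P * 'X) A = cpoly P A * A.
Proof.
rewrite (@cpoly_widen (size P).+1); last first.
  by apply: leq_trans (size_polyMleq _ _) _; rewrite size_polyX addn2.
rewrite big_ord_recl/= coefMX eqxx scale0r add0r /cpoly mulr_suml.
by apply: eq_bigr => i _; rewrite coefMX/= bop_scalerAl exprSr.
Qed.

Lemma cpolyM P Q A : cpoly (P * Q) A = cpoly P A * cpoly Q A.
Proof.
elim/poly_ind: Q => [|Q c IH].
  have c0 : cpoly 0 A = 0 by rewrite /cpoly size_poly0 big_ord0.
  by rewrite mulr0 c0 mulr0.
rewrite mulrDr mulrA !cpolyD !cpolyMX IH mulrDr mulrA; congr (_ + _).
by rewrite mulrC mul_polyC cpolyZ cpolyC bop_scalerAr mulr1.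
Qed.

Lemma opolyD p q A : opoly (p + q) A = opoly p A + opoly q A.
Proof. by rewrite !opolyE rmorphD/= cpolyD. Qed.

Lemma opolyC (a : R) A : opoly a%:P A = a%:C *: (1 : bounded_op H).
Proof. by rewrite opolyE map_polyC cpolyC. Qed.

Lemma opolyX A : opoly 'X A = A.
Proof.
by rewrite opolyE map_polyX -[X in cpoly X]mul1r cpolyMX cpolyC scale1r mul1r.
Qed.

Lemma opolyM p q A : opoly (p * q) A = opoly p A * opoly q A.
Proof. by rewrite !opolyE rmorphM/= cpolyM. Qed.

Lemma opolyN p A : opoly (- p) A = - opoly p A.
Proof.
by rewrite -mulN1r -[in LHS]polyCN opolyM opolyC bop_scalerAl mul1r rmorphN/= scaleN1r.
Qed.

Lemma opolyB p q A : opoly (p - q) A = opoly p A - opoly q A.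
Proof. by rewrite opolyD opolyN. Qed.

Lemma opoly_intertwine (X A B : bounded_op H) p :
  X * A = B * X -> X * opoly p A = opoly p B * X.
Proof.
move=> XA; rewrite /opoly mulr_sumr mulr_suml; apply: eq_bigr => i _.
rewrite bop_scalerAr bop_scalerAl; congr (_ *: _).
elim: (nat_of_ord i) => [|k IH]; first by rewrite !expr0 mulr1 mul1r.
by rewrite exprSr mulrA IH -mulrA XA mulrA -exprSr.
Qed.

Lemma selfadjD S T : selfadj S -> selfadj T -> selfadj (S + T).
Proof.
by move=> sS sT x y /=; rewrite (linearDl inner) (linearDr inner)/= sS sT.
Qed.

Lemma selfadjZ (a : R) S : selfadj S -> selfadj (a%:C *: S).
Proof.
move=> sS x y /=; rewrite (linearZl_LR inner) (linearZr_LR inner)/= sS.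
by congr (_ * _); exact/esym/conjc_real.
Qed.

Lemma selfadjN S : selfadj S -> selfadj (- S).
Proof. by move=> sS x y /=; rewrite (linearNl inner) (linearNr inner)/= sS. Qed.

Lemma selfadjB S T : selfadj S -> selfadj T -> selfadj (S - T).
Proof. by move=> sS sT; apply: selfadjD => //; exact: selfadjN. Qed.

Lemma selfadjX S k : selfadj S -> selfadj (S ^+ k).
Proof.
move=> sS; elim: k => [|k IH]; first by rewrite expr0.
move=> x y; rewrite [in LHS]exprS exprSr.
by apply: etrans (sS ((S ^+ k) x) y) _; exact: IH.
Qed.

Lemma selfadj_opoly p A : selfadj A -> selfadj (opoly p A).
Proof.
move=> sA; apply: (big_ind (@selfadj _ H)) => [|S T|i _].
- by move=> x y /=; rewrite (linear0l inner) (linear0r inner).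
- exact: selfadjD.
- exact/selfadjZ/selfadjX.
Qed.

Lemma bop_invertibleM S T :
  bop_invertible S -> bop_invertible T -> bop_invertible (S * T).
Proof.
move=> [S' [S'S SS']] [T' [T'T TT']]; exists (T' * S'); split.
  by rewrite mulrA -[T' * S' * S]mulrA S'S mulr1 T'T.
by rewrite mulrA -[S * T * T']mulrA TT' mulr1 SS'.
Qed.

Lemma bop_invertibleZ (a : R[i]) S :
  a != 0 -> bop_invertible S -> bop_invertible (a *: S).
Proof.
move=> a0 [S' [S'S SS']]; exists (a^-1 *: S').
by rewrite !bop_scalerAl !bop_scalerAr !scalerA mulVf// mulfV// !scale1r.
Qed.

Lemma bop_invertibleN S : bop_invertible S -> bop_invertible (- S).
Proof. by rewrite -scaleN1r; apply: bop_invertibleZ; rewrite oppr_eq0 oner_eq0. Qed.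

(** A left inverse and a right inverse of [S] are read off an inverse of [S * T];
    they coincide. *)
Lemma bop_invertible_comm S T :
  S * T = T * S -> bop_invertible (S * T) -> bop_invertible S.
Proof.
move=> ST [W [WST STW]]; exists (T * W); split; last by rewrite mulrA.
have WTS : W * T * S = 1 by rewrite -mulrA -ST.
suff -> : T * W = W * T by [].
by rewrite -[LHS]mul1r -WTS -!mulrA [S * _]mulrA STW mulr1.
Qed.

(** Half of the spectral mapping theorem: if the linear factors of [P] are all
    invertible at [A], so is their product. *)
Lemma cpoly_singular_root P A : P != 0 -> ~ bop_invertible (cpoly P A) ->
  exists2 z, spectrum A z & root P z.
Proof.
move=> P0 nP; apply: contrapT => nz; apply: nP.
have [r Pr] := closed_field_poly_normal P.
have lc0 : lead_coef P != 0 by rewrite lead_coef_eq0.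
rewrite Pr cpolyZ; apply: bop_invertibleZ => //.
have {nz} : forall z, z \in r -> bop_invertible (z *: (1 : bounded_op H) - A).
  move=> z zr; apply: contrapT => hz; apply: nz; exists z => //.
  by rewrite Pr rootZ// root_prod_XsubC.
elim: r {Pr} => [|z r IH] h.
  by rewrite big_nil cpolyC scale1r; exists 1; rewrite !mulr1.
rewrite big_cons cpolyM; apply: bop_invertibleM; last first.
  by apply: IH => w wr; apply: h; rewrite inE wr orbT.
rewrite -polyCN cpolyD -[X in cpoly X]mul1r cpolyMX !cpolyC scale1r mul1r.
rewrite scaleNr -opprB; apply: bop_invertibleN; apply: h.
by rewrite inE eqxx.
Qed.

End polynomial_calculus.

Section spectral_positivity.
Variables (R : realType) (H : hilbertType R).
Implicit Types (A B P S T : bounded_op H) (p q : {poly R}).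

Definition pos_op A := forall x, 0 <= rinner (A x) x.

Lemma ler_op_rinner A x : rinner (A x) x <= opnorm A * rnorm x ^+ 2.
Proof.
apply: le_trans (ler_norm _) _; apply: le_trans (ler_rinner _ _) _.
by rewrite expr2 mulrA ler_wpM2r ?rnorm_ge0// ler_opnorm.
Qed.

(** Cauchy-Schwarz for the semi-definite form [<P x, y>], evaluated at
    [y = P x]; the [+ 1] keeps the constant positive. *)
Lemma pos_op_sqr_le P x : selfadj P -> pos_op P ->
  rnorm (P x) ^+ 2 <= (opnorm P + 1) * rinner (P x) x.
Proof.
move=> sP pP; set K := opnorm P + 1.
have K0 : 0 < K by rewrite ltr_wpDl ?opnorm_ge0.
rewrite -ler_pdivrMl//.
have := pP (x - K^-1%:C *: P x).
rewrite linearB linearZ/= !rinnerBl !rinnerBr !rinnerZl !rinnerZr.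
rewrite (selfadj_rinner sP (P x) x) (rinner_normE (P x)).
have := ler_op_rinner P (P x).
set b := rinner (P (P x)) (P x); set a := rinner (P x) x; set r := _ ^+ 2.
move=> h1 h2.
have : K^-1 * (K^-1 * b) <= K^-1 * r.
  rewrite ler_pM2l ?invr_gt0// mulrC ler_pdivrMr//.
  apply: le_trans h1 _; rewrite [r * K]mulrC ler_wpM2r ?sqr_ge0// /K; lra.
lra.
Qed.

(** Let [m] be the infimum and [P = B - m].  If [P] had a bounded inverse,
    [pos_op_sqr_le] would bound [<P x, x>] away from 0 on unit vectors, against
    the choice of [m]. *)
Lemma numrange_inf_spectrum B : selfadj B -> (exists x : H, rnorm x = 1) ->
  exists2 m, real_spectrum B m & forall x, m * rnorm x ^+ 2 <= rinner (B x) x.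
Proof.
move=> sB [x0 x01].
pose V := [set rinner (B x) x | x in [set x : H | rnorm x = 1]].
have hV : has_inf V.
  split; first by exists (rinner (B x0) x0), x0.
  exists (- opnorm B) => _ [x /= x1 <-].
  have := ler_op_rinner (- B) x; rewrite /= rinnerNl opnormN x1 expr1n mulr1.
  by rewrite lerNl.
pose m := inf V.
have mB x : m * rnorm x ^+ 2 <= rinner (B x) x.
  have [x_0|xn0] := eqVneq (rnorm x) 0.
    by rewrite (rnorm_eq0 x_0) linear0 rinner0l rnorm0 expr0n mulr0.
  have xp : 0 < rnorm x by rewrite lt_def xn0 rnorm_ge0.
  rewrite -ler_pdivlMr ?exprn_gt0//.
  apply: (ge_inf hV.2); exists ((rnorm x)^-1%:C *: x).
    by rewrite /= rnormZr ger0_norm ?invr_ge0 ?rnorm_ge0// mulVf.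
  by rewrite linearZ/= rinnerZl rinnerZr mulrA -invfM -expr2 mulrC.
exists m => //; rewrite /real_spectrum /spectrum/= => inv.
have := bop_invertibleN inv; rewrite opprB; set P := B - _ => -[S [SP _]].
have PE x : rinner (P x) x = rinner (B x) x - m * rnorm x ^+ 2.
  by rewrite /P /= rinnerBl rinnerZl rinner_normE.
have sP : selfadj P by apply: selfadjB => //; exact: selfadjZ.
have pP : pos_op P by move=> x; rewrite PE subr_ge0.
pose K := opnorm S ^+ 2 * (opnorm P + 1) + 1.
have K0 : 0 < K by rewrite ltr_wpDl// mulr_ge0 ?sqr_ge0 ?addr_ge0 ?opnorm_ge0.
have Ki : 0 < K^-1 by rewrite invr_gt0.
have [_ [x /= x1 <-]] := inf_adherent Ki hV.
rewrite -/m -ltrBlDl => xm.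
have : rnorm x ^+ 2 <= opnorm S ^+ 2 * rnorm (P x) ^+ 2.
  rewrite -exprMn ler_sqr ?nnegrE ?mulr_ge0 ?rnorm_ge0 ?opnorm_ge0//.
  by apply: le_trans (ler_opnorm _ _); rewrite -[S (P x)]/((S * P) x) SP.
have := pos_op_sqr_le x sP pP; rewrite PE x1 expr1n mulr1 => h1 h2.
have : 1 <= opnorm S ^+ 2 * (opnorm P + 1) * (rinner (B x) x - m).
  by apply: le_trans h2 _; rewrite -mulrA ler_wpM2l ?sqr_ge0.
have d0 : 0 <= rinner (B x) x - m by have := pP x; rewrite PE x1 expr1n mulr1.
have : K * (rinner (B x) x - m) < 1 by rewrite mulrC -ltr_pdivlMr// div1r.
rewrite /K mulrDl mul1r; move: (_ * _) => u; lra.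
Qed.

(** For [z = a + i b] with [b] non-zero, [(z - A) (z^* - A) = (a - A)^2 + b^2] is
    coercive, hence invertible, and its factors commute. *)
Lemma selfadj_spectrum_real A z : selfadj A -> spectrum A z -> complex.Im z = 0.
Proof.
case: z => a b sA; apply: contra_notP => /= /eqP b0.
have sD : selfadj (a%:C *: (1 : bounded_op H) - A).
  by apply: selfadjB => //; exact: selfadjZ.
set D := _ - A in sD.
have -> : (a +i* b) *: (1 : bounded_op H) - A = D + ('i * b%:C) *: (1 : bounded_op H).
  by rewrite /D addrAC -scalerDl (complexE (a +i* b)).
clearbody D.
set U := D + _; pose V := D - ('i * b%:C) *: (1 : bounded_op H).
have ii : 'i * b%:C * ('i * b%:C) = - (b ^+ 2)%:C :> R[i].
  by rewrite mulrACA -expr2 sqr_i mulN1r rmorphXn -expr2.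
have UV : U * V = D * D + (b ^+ 2)%:C *: (1 : bounded_op H).
  rewrite /U /V mulrDl !mulrBr !bop_scalerAl !bop_scalerAr !mul1r mulr1.
  rewrite scalerA ii.
  by rewrite addrA subrK scaleNr opprK.
apply: (@bop_invertible_comm _ _ U V).
  rewrite UV /U /V mulrBl !mulrDr !bop_scalerAl !bop_scalerAr !mul1r mulr1.
  rewrite scalerA ii.
  by rewrite opprD addrA addrK scaleNr opprK.
have b2 : 0 < b ^+ 2 by rewrite exprn_even_gt0.
rewrite UV; apply: (coercive_invertible b2).
  apply: selfadjD; last exact: selfadjZ.
  by move=> x y /=; rewrite !sD.
move=> x /=; rewrite rinnerDl rinnerZl rinner_normE (selfadj_rinner sD).
by rewrite lerDr rinner_normE sqr_ge0.
Qed.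

(** If [p(A)] is not positive, the infimum [m] of its numerical range is negative
    and in its spectrum, so [m = p(t)] for some [t] in the spectrum of [A]. *)
Lemma opoly_pos p A : selfadj A ->
  (forall t, real_spectrum A t -> 0 <= p.[t]) -> pos_op (opoly p A).
Proof.
move=> sA p0 x; apply/negP => /negP; rewrite -ltNge => px.
have xn0 : rnorm x != 0.
  by apply/eqP => /rnorm_eq0 x0; move: px; rewrite x0 linear0 rinner0l ltxx.
have unit_vector : exists y : H, rnorm y = 1.
  exists ((rnorm x)^-1%:C *: x).
  by rewrite rnormZr ger0_norm ?invr_ge0 ?rnorm_ge0// mulVf.
have [m sm mp] := numrange_inf_spectrum (selfadj_opoly p sA) unit_vector.
have m0 : m < 0.
  have := le_lt_trans (mp x) px.
  by rewrite pmulr_llt0// exprn_gt0// lt_def xn0 rnorm_ge0.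
suff [t st pt] : exists2 t, real_spectrum A t & p.[t] = m.
  by have := p0 t st; rewrite pt leNgt m0.
(* If [p] is the constant [m] there is nothing to factor: any point of the spectrum
   will do, and there is one because the space is not zero. *)
have [pm|pm] := eqVneq p m%:P.
  have [t st _] := numrange_inf_spectrum sA unit_vector.
  by exists t => //; rewrite pm hornerC.
pose Q := map_poly (real_complex R) (m%:P - p).
have Q0 : Q != 0 by rewrite map_poly_eq0 subr_eq0 eq_sym.
have [|z sz rz] := @cpoly_singular_root _ _ Q A Q0.
  by rewrite -opolyE opolyB opolyC.
have zr := selfadj_spectrum_real sA sz.
have zE : z = (complex.Re z)%:C by case: (z) zr => a b /= ->.
exists (complex.Re z); first by rewrite /real_spectrum/= -zE.
move: rz; rewrite zE /Q /root horner_map/= hornerD hornerN hornerC.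
rewrite (_ : 0 = 0%:C)// (inj_eq (@complexI _)) subr_eq0 => /eqP ->.
by [].
Qed.

(** Apply [opoly_pos] to [c^2 - p^2]. *)
Lemma opoly_opnorm_le p A (c : R) : selfadj A -> 0 <= c ->
  (forall t, real_spectrum A t -> `|p.[t]| <= c) -> opnorm (opoly p A) <= c.
Proof.
move=> sA c0 pc; apply: opnorm_le => // x.
rewrite -ler_sqr ?nnegrE ?mulr_ge0 ?rnorm_ge0//.
have := @opoly_pos ((c ^+ 2)%:P - p * p) A sA _ x.
rewrite opolyB opolyC opolyM /= rinnerBl rinnerZl !rinner_normE.
rewrite (selfadj_rinner (selfadj_opoly p sA)) rinner_normE exprMn subr_ge0.
apply=> t st; rewrite hornerD hornerC hornerN hornerM subr_ge0 -expr2.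
by rewrite -real_normK ?num_real// ler_sqr ?nnegrE ?normr_ge0// pc.
Qed.

Lemma real_spectrum_ge0 A t : selfadj A -> pos_op A -> real_spectrum A t -> 0 <= t.
Proof.
move=> sA pA st; rewrite leNgt; apply/negP => t0; apply: st.
rewrite -opprB; apply: bop_invertibleN.
have nt0 : 0 < - t by rewrite oppr_gt0.
apply: (coercive_invertible nt0); first by apply: selfadjB => //; exact: selfadjZ.
by move=> x /=; rewrite rinnerBl rinnerZl rinner_normE mulNr lerDr pA.
Qed.

Lemma real_spectrum_le A t : selfadj A -> real_spectrum A t -> t <= opnorm A.
Proof.
move=> sA st; rewrite leNgt; apply/negP => tA; apply: st.
have t0 : 0 < t - opnorm A by rewrite subr_gt0.
apply: (coercive_invertible t0); first by apply: selfadjB => //; exact: selfadjZ.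
move=> x /=; rewrite rinnerBl rinnerZl rinner_normE mulrBl lerD2l lerN2.
exact: ler_op_rinner.
Qed.

Lemma selfadj_sqrE S x :
  selfadj S -> rnorm (S x) ^+ 2 = rinner ((S ^+ 2) x) x.
Proof. by move=> sS; rewrite expr2 /= (selfadj_rinner sS) rinner_normE. Qed.

Lemma selfadj_norm_le S x :
  selfadj S -> rnorm (S x) <= Num.sqrt (opnorm (S ^+ 2)) * rnorm x.
Proof.
move=> sS; rewrite -ler_sqr ?nnegrE ?mulr_ge0 ?sqrtr_ge0 ?rnorm_ge0//.
rewrite selfadj_sqrE// exprMn sqr_sqrtr ?opnorm_ge0//; exact: ler_op_rinner.
Qed.

End spectral_positivity.

(** * Polynomial approximation and real powers *)

Section weierstrass.
Variable R : realType.
Implicit Types (f : R -> R) (a b t x y : R).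

(** Heine-Cantor together with boundedness: pairs further apart than the modulus
    of uniform continuity are absorbed by the quadratic term. *)
Lemma quadratic_modulus f a b : a <= b -> {within `[a, b], continuous f} ->
  forall e, 0 < e -> exists2 K : R, 0 <= K &
    forall x y, a <= x <= b -> a <= y <= b -> `|f y - f x| <= e + K * (y - x) ^+ 2.
Proof.
move=> ab cf e e0.
have [B B0 fB] : exists2 B : R, 0 <= B & forall x, a <= x <= b -> `|f x| <= B.
  have [c _ fc] := EVT_max ab cf; have [d _ fd] := EVT_min ab cf.
  exists (`|f c| + `|f d|) => [|x xab]; first by rewrite addr_ge0.
  have xi : x \in `[a, b] by rewrite in_itv.
  have := fc x xi; have := fd x xi.
  have := ler_norm (f c); have := lerNnormlW (lexx `|f d|).
  rewrite ler_norml; have := normr_ge0 (f c); have := normr_ge0 (f d); lra.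
have unif : \forall n \near \oo, `[a, b] `<=` (fun x => forall y, a <= y <= b ->
    `|x - y| < n.+1%:R^-1 -> `|f y - f x| <= e).
  have /compact_near_coveringP/near_covering_withinP := @segment_compact R a b.
  apply => x /=; rewrite in_itv/= => xab.
  have /subspace_continuousP/(_ x) : {within `[a, b], continuous f} by [].
  rewrite /= in_itv/= => /(_ xab)/cvgrPdist_lt/(_ (e / 2)).
  rewrite divr_gt0// => /(_ isT)[d /= d0 hd].
  have fd z : `|x - z| < d -> a <= z <= b -> `|f x - f z| < e / 2.
    by move=> xz zab; apply: (hd z) => //; rewrite /= in_itv.
  have d20 : 0 < d / 2 by rewrite divr_gt0.
  exists (ball x (d / 2), [set n | n.+1%:R^-1 < d / 2]).
    split => /=; first exact: nbhsx_ballx.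
    exact: near_infty_natSinv_lt (PosNum d20).
  case=> x' n [/= xx' nd]; rewrite in_itv/= => x'ab y yab x'y.
  have h1 := fd x' (lt_trans xx' _) x'ab.
  have h2 : `|f x - f y| < e / 2.
    apply: fd => //; rewrite -(subrKA x'); apply: le_lt_trans (ler_normD _ _) _.
    rewrite [X in _ < X]splitr ltrD//; exact: lt_trans x'y nd.
  rewrite -(subrKA (f x)); apply: le_trans (ler_normD _ _) _.
  rewrite distrC [leRHS]splitr lerD// ltW// h1//.
  by rewrite ltr_pdivrMr// ltr_pMr// ltr1n.
have [N _ /(_ N (leqnn _)) hN] := unif.
exists (2 * B * N.+1%:R ^+ 2) => [|x y xab yab]; first by rewrite !mulr_ge0.
have [xy|xy] := ltP `|x - y| N.+1%:R^-1.
  apply: le_trans (hN x _ y yab xy) _; first by rewrite /= in_itv.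
  by rewrite lerDl mulr_ge0 ?sqr_ge0 ?mulr_ge0.
apply: (@le_trans _ _ (2 * B)).
  apply: le_trans (ler_normB _ _) _; have := fB _ xab; have := fB _ yab; lra.
rewrite ler_wpDl ?(ltW e0)// -mulrA ler_peMr ?mulr_ge0//.
rewrite -exprMn -real_normK ?num_real// exprn_ege1// normrM distrC.
by rewrite ger0_norm// mulrC -ler_pdivrMr// div1r.
Qed.

(** The Bernstein polynomial of [phi : {0, ..., n} -> R], that is
    [\sum_k 'C(n, k) phi k 'X^k (1 - 'X)^(n - k)], by conditioning the binomial
    law on its first trial. *)
Fixpoint bernstein n (phi : nat -> R) : {poly R} :=
  if n is m.+1 then 'X * bernstein m (phi \o S) + (1 - 'X) * bernstein m phi
  else (phi 0%N)%:P.

Lemma bernsteinS n phi t : (bernstein n.+1 phi).[t] =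
  t * (bernstein n (phi \o S)).[t] + (1 - t) * (bernstein n phi).[t].
Proof. by rewrite /= !hornerE. Qed.

Lemma bernsteinD n phi psi t : (bernstein n (phi \+ psi)).[t] =
  (bernstein n phi).[t] + (bernstein n psi).[t].
Proof.
elim: n phi psi => [|n IH] phi psi; first by rewrite /= !hornerE.
by rewrite !bernsteinS -[(phi \+ psi) \o S]/((phi \o S) \+ (psi \o S)) !IH; ring.
Qed.

Lemma bernsteinZ n (c : R) phi t :
  (bernstein n (fun k => c * phi k)).[t] = c * (bernstein n phi).[t].
Proof.
elim: n phi => [|n IH] phi; first by rewrite /= !hornerE.
by rewrite !bernsteinS -[_ \o S]/(fun k => c * (phi \o S) k) !IH; ring.
Qed.

Lemma bernstein_cst n (c : R) t : (bernstein n (fun=> c)).[t] = c.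
Proof.
elim: n => [|n IH]; first by rewrite /= hornerC.
by rewrite bernsteinS -[_ \o S]/(fun=> c) IH; ring.
Qed.

(** The second moment of the binomial law about [c]: variance plus squared bias. *)
Lemma bernstein_sqr n (c : R) t : (bernstein n (fun k => (k%:R - c) ^+ 2)).[t] =
  n%:R * (t * (1 - t)) + (n%:R * t - c) ^+ 2.
Proof.
elim: n c => [|n IH] c; first by rewrite /= hornerC; ring.
rewrite bernsteinS (_ : _ \o S = fun k => (k%:R - (c - 1)) ^+ 2); last first.
  by apply/funext => k /=; rewrite -natr1; ring.
by rewrite !IH -natr1; ring.
Qed.

Lemma bernstein_le n phi psi t : 0 <= t <= 1 ->
  (forall k, (k <= n)%N -> phi k <= psi k) ->
  (bernstein n phi).[t] <= (bernstein n psi).[t].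
Proof.
move=> /andP[t0 t1]; elim: n phi psi => [|n IH] phi psi h.
  by rewrite /= !hornerC h.
rewrite !bernsteinS lerD// ler_wpM2l ?subr_ge0//; apply: IH => k kn.
  exact: h.
by apply: h; exact: leqW.
Qed.

(** The quadratic modulus of [f] turns the error of the Bernstein polynomial into
    the variance of the binomial law, of order [1 / n]. *)
Theorem weierstrass_approximation f a b : a < b -> {within `[a, b], continuous f} ->
  forall e, 0 < e -> exists q : {poly R}, forall t, a <= t <= b -> `|q.[t] - f t| <= e.
Proof.
move=> ab cf e e0; have e20 : 0 < e / 2 by rewrite divr_gt0.
have [K K0 fK] := quadratic_modulus (ltW ab) cf e20.
have ba0 : 0 < b - a by rewrite subr_gt0.
pose C := K * (b - a) ^+ 2.
have C0 : 0 <= C by rewrite mulr_ge0 ?sqr_ge0.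
pose n := (Num.truncn (C / (e / 2))).+1.
have n0 : 0 < n%:R :> R by rewrite ltr0n.
have Cn : C / n%:R <= e / 2.
  by rewrite ler_pdivrMr// mulrC -ler_pdivrMr// ltW// truncnS_gt.
pose node k := a + (b - a) * (k%:R / n%:R).
pose q := bernstein n (f \o node) \Po ((b - a)^-1 *: ('X - a%:P)).
exists q => t /andP[at_ tb]; pose s := (b - a)^-1 * (t - a).
have s01 : 0 <= s <= 1.
  rewrite /s mulr_ge0 ?invr_ge0 ?(ltW ba0) ?subr_ge0//=.
  by rewrite mulrC ler_pdivrMr// mul1r lerB.
have qE : q.[t] = (bernstein n (f \o node)).[s].
  by rewrite /q horner_comp !hornerE.
have node_t k : node k - t = (b - a) / n%:R * (k%:R - n%:R * s).
  by rewrite /node /s; field; rewrite !gt_eqF.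
pose err k := e / 2 + C / n%:R ^+ 2 * (k%:R - n%:R * s) ^+ 2.
have errE : (bernstein n err).[s] <= e.
  rewrite (bernsteinD n (fun=> e / 2)
    (fun k => C / n%:R ^+ 2 * (k%:R - n%:R * s) ^+ 2)) bernstein_cst.
  rewrite bernsteinZ bernstein_sqr subrr expr0n addr0.
  rewrite [leRHS]splitr lerD2l; apply: le_trans Cn.
  have -> : C / n%:R ^+ 2 * (n%:R * (s * (1 - s))) = C / n%:R * (s * (1 - s)).
    by field; rewrite gt_eqF.
  rewrite ler_piMr ?divr_ge0// ?ltW//.
  by case/andP: s01 => s0 s1; nra.
have near_t k : (k <= n)%N -> `|f (node k) - f t| <= err k.
  move=> kn; have -> : err k = e / 2 + K * (node k - t) ^+ 2.
    by rewrite node_t /err /C; field; rewrite gt_eqF.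
  apply: fK; first by rewrite at_ tb.
  rewrite /node lerDl mulr_ge0 ?(ltW ba0) ?divr_ge0//=.
  by rewrite -lerBrDl ler_piMr ?(ltW ba0)// ler_pdivrMr// mul1r ler_nat.
rewrite qE ler_norml; apply/andP; split.
  rewrite -subr_ge0 opprK -[f t](bernstein_cst n (f t) s).
  suff : (bernstein n (fun=> f t)).[s] <= (bernstein n ((f \o node) \+ err)).[s].
    by rewrite bernsteinD; move: errE; lra.
  apply: bernstein_le => // k kn; have := near_t k kn.
  by rewrite ler_norml /=; lra.
rewrite -[X in _ - X](bernstein_cst n (f t) s).
suff : (bernstein n (f \o node)).[s] <= (bernstein n ((fun=> f t) \+ err)).[s].
  by rewrite bernsteinD; move: errE; lra.
apply: bernstein_le => // k kn; have := near_t k kn.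
by rewrite ler_norml /=; lra.
Qed.

End weierstrass.

Section power_functions.
Variable R : realType.

(** Young's inequality for the exponents [p] and [p / (p - 1)] says that
    [t |-> t `^ p] lies above its tangent line at [s]. *)
Lemma powR_tangent (p s t : R) : 1 <= p -> 0 <= s -> 0 <= t ->
  p * s `^ (p - 1) * t - (p - 1) * s `^ p <= t `^ p.
Proof.
rewrite le_eqVlt => /predU1P[<- s0 t0|p1 s0 t0].
  by rewrite subrr powRr0 mul0r subr0 !mul1r powRr1.
have p0 : 0 < p by apply: lt_trans p1.
have p10 : 0 < p - 1 by rewrite subr_gt0.
have := @conjugate_powR R t (s `^ (p - 1)) p (p / (p - 1)) t0 (powR_ge0 _ _) p0.
rewrite divr_gt0// => /(_ isT); rewrite invf_div.
have -> : p^-1 + (p - 1) / p = 1 by field; rewrite gt_eqF.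
move=> /(_ erefl); rewrite -powRrM (_ : (p - 1) * (p / (p - 1)) = p); last first.
  by field; rewrite gt_eqF.
rewrite -(ler_pM2l p0).
have -> : p * (t `^ p / p + s `^ p * ((p - 1) / p)) =
    t `^ p + (p - 1) * s `^ p by field; rewrite gt_eqF.
lra.
Qed.

(** At 0 the power is dominated by the identity, away from 0 it is
    differentiable. *)
Lemma powR_within_continuous (p : R) : 1 <= p ->
  {within `[0, +oo[, continuous (fun t : R => t `^ p)}.
Proof.
move=> p1; apply/subspace_continuousP => x; rewrite /from_subspace/= in_itv/= andbT.
rewrite le_eqVlt => /predU1P[<-|x0].
  apply/cvgrPdist_le => e e0.
  have p0 : p != 0 by rewrite gt_eqF// (lt_le_trans ltr01).
  have m0 : 0 < Num.min 1 e by rewrite lt_min ltr01.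
  exists (Num.min 1 e) => //= t /=; rewrite powR0// !sub0r !normrN lt_min.
  move=> /andP[t1 te].
  rewrite in_itv/= andbT => t0; rewrite ger0_norm ?powR_ge0//.
  rewrite ger0_norm// in t1 te; move: t0; rewrite le_eqVlt => /predU1P[<-|tp].
    by rewrite powR0// ltW.
  apply: le_trans (ltW te); apply: ge1r_powR => //.
  by rewrite tp ltW.
apply: cvg_within_filter.
have : {for x, continuous (fun t : R => t `^ p)}; last exact.
apply/differentiable_continuous/derivable1_diffP.
by apply: derivable_powR; rewrite in_itv/= x0.
Qed.

End power_functions.

(** * The continuous functional calculus *)

Section functional_calculus.
Variables (R : realType) (H : hilbertType R).
Implicit Types (A B F G S T X : bounded_op H) (f g h : R -> R) (p q : {poly R}).

(** The bounded operators are complete: pointwise limits of an operator-norm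
    Cauchy sequence are linear, and the convergence is uniform. *)
Lemma opnorm_cauchy_cvg (U : nat -> bounded_op H) :
  (forall e : R, 0 < e -> exists N, forall m n, (N <= m)%N -> (N <= n)%N ->
     opnorm (U m - U n) <= e) ->
  exists L, forall e : R, 0 < e -> exists N, forall n, (N <= n)%N ->
     opnorm (U n - L) <= e.
Proof.
move=> UC.
have /choice[l Ul] : forall x : H, exists l, forall e : R, 0 < e ->
    exists N, forall n, (N <= n)%N -> rnorm (U n x - l) <= e.
  move=> x; apply: rnorm_cauchy_cvg => e e0.
  have x1 : 0 < rnorm x + 1 by rewrite ltr_wpDl ?rnorm_ge0.
  have [N hN] := UC (e / (rnorm x + 1)) (divr_gt0 e0 x1).
  exists N => m n Nm Nn; have := ler_opnorm (U m - U n) x; move/le_trans; apply.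
  apply: le_trans (ler_wpM2r (rnorm_ge0 x) (hN _ _ Nm Nn)) _.
  rewrite mulrAC -mulrA ler_piMr ?(ltW e0)// ler_pdivrMr// mul1r; lra.
have Ulim e : 0 < e -> exists N, forall n, (N <= n)%N ->
    forall x, rnorm (U n x - l x) <= e * rnorm x.
  move=> e0; have [N hN] := UC e e0; exists N => n Nn x.
  apply/ler_addgt0Pr => d d0; have [N' hN'] := Ul x d d0.
  have h1 := hN n (maxn N N') Nn (leq_maxl _ _).
  have h2 := hN' (maxn N N') (leq_maxr _ _).
  rewrite -[U n x](subrK (U (maxn N N') x)) -addrA.
  apply: le_trans (ler_rnormD _ _) (lerD _ h2).
  apply: le_trans (ler_opnorm (U n - U (maxn N N')) x) _.
  by rewrite ler_wpM2r ?rnorm_ge0.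
have llin : linear l.
  move=> a x y; apply/eqP; rewrite -subr_eq0; apply/eqP/rnorm_eq0/eqP.
  rewrite eq_le rnorm_ge0 andbT; apply/ler_addgt0Pr => d d0; rewrite add0r.
  pose K := rnorm (a *: x + y) + rnorm a * rnorm x + rnorm y + 1.
  have K0 : 0 < K by rewrite ltr_wpDl// !addr_ge0 ?mulr_ge0 ?rnorm_ge0.
  have [N /(_ N (leqnn _)) hN] := Ulim (d / K) (divr_gt0 d0 K0).
  have -> : l (a *: x + y) - (a *: l x + l y) =
     - (U N (a *: x + y) - l (a *: x + y)) +
     (a *: (U N x - l x) + (U N y - l y)).
    rewrite (bop_linear (U N)) scalerBr opprB [X in _ = _ + X]addrACA -opprD.
    by rewrite addrA subrK.
  apply: le_trans (ler_rnormD _ _) _; rewrite rnormN.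
  apply: le_trans (lerD (hN _) (le_trans (ler_rnormD _ _)
    (lerD (lexx _) (hN _)))) _.
  rewrite rnormZ; apply: (@le_trans _ _ (d / K * (rnorm (a *: x + y) +
     (rnorm a * rnorm x + rnorm y)))).
    rewrite !mulrDr lerD2l lerD2r mulrCA ler_wpM2l ?rnorm_ge0//.
  rewrite mulrAC -mulrA ler_piMr ?(ltW d0)// ler_pdivrMr// mul1r /K; lra.
have lbd : exists M, forall x, rnorm (l x) <= M * rnorm x.
  have [N /(_ N (leqnn _)) hN] := Ulim 1 ltr01.
  exists (opnorm (U N) + 1) => x.
  rewrite -[l x](subrK (U N x)) addrC mulrDl.
  by apply: le_trans (ler_rnormD _ _) _; rewrite lerD ?ler_opnorm// rnormB.
exists (BoundedOp llin lbd) => e e0; have [N hN] := Ulim e e0.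
by exists N => n Nn; apply: opnorm_le => [|x]; [exact: ltW|exact: hN].
Qed.

(** The limit that defines the functional calculus, one tolerance and one
    polynomial at a time: this form combines easily under algebraic operations. *)
Definition cfc_approx f A F := forall e : R, 0 < e ->
  exists2 q, (forall t, real_spectrum A t -> `|q.[t] - f t| <= e) &
             opnorm (opoly q A - F) <= e.

Lemma is_cfc_approx f A F : is_cfc f A F -> cfc_approx f A F.
Proof.
move=> [p pf pF] e e0.
have h1 : \forall k \near \oo, forall t, real_spectrum A t -> `|(p k).[t] - f t| <= e.
  apply: (pf [set u | forall t, real_spectrum A t -> `|u t - f t| <= e]).
  apply/uniform_nbhs; exists [set xy | ball xy.1 e xy.2]; split.
    exact: (entourage_ball _ (PosNum e0)).
  by move=> u /= h t /h; rewrite /ball/= distrC => /ltW.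
have h2 : \forall k \near \oo, opnorm (opoly (p k) A - F) <= e.
  move/cvgrPdist_le : pF => /(_ e e0); apply: filterS => k.
  by rewrite sub0r normrN ger0_norm ?opnorm_ge0.
have [N _ /(_ N (leqnn _)) hN] : \forall k \near \oo,
    (forall t, real_spectrum A t -> `|(p k).[t] - f t| <= e) /\
    opnorm (opoly (p k) A - F) <= e.
  by near=> k; split; [near: k|near: k].
by exists (p N); case: hN.
Unshelve. all: by end_near. Qed.

Lemma approx_is_cfc f A F : cfc_approx f A F -> is_cfc f A F.
Proof.
move=> fAF.
have /choice[p pP] : forall n : nat, exists q,
    (forall t, real_spectrum A t -> `|q.[t] - f t| <= n.+1%:R^-1) /\
    opnorm (opoly q A - F) <= n.+1%:R^-1.
  move=> n; have [|q h1 h2] := fAF n.+1%:R^-1; first by rewrite invr_gt0.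
  by exists q.
exists p.
  move=> W /uniform_nbhs[E [/= ]]; rewrite -entourage_ballE => -[e /= e0 eE] EW.
  have e20 : 0 < e / 2 by rewrite divr_gt0.
  have [N hN] := invS_le e20; exists N => // k /= Nk; apply: EW => t st.
  apply: eE => /=; rewrite /ball/= distrC.
  apply: le_lt_trans ((pP k).1 t st) _; apply: le_lt_trans (hN k Nk) _.
  by rewrite ltr_pdivrMr// ltr_pMr// ltr1n.
apply/cvgrPdist_le => e e0; have [N hN] := invS_le e0.
exists N => // k /= Nk; rewrite sub0r normrN ger0_norm ?opnorm_ge0//.
exact: le_trans (pP k).2 (hN k Nk).
Qed.

Section calculus_rules.
Variables (A : bounded_op H) (sA : selfadj A).

(** By [opoly_opnorm_le], polynomials that are uniformly Cauchy on the spectrum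
    are Cauchy in the operator norm. *)
Lemma cfc_exists f :
  (forall e : R, 0 < e ->
     exists q, forall t, real_spectrum A t -> `|q.[t] - f t| <= e) ->
  cfc_approx f A (cfc f A).
Proof.
move=> fp; suff [F AF] : exists F, cfc_approx f A F.
  apply: is_cfc_approx; rewrite /cfc; case: xgetP => [B _ //|/(_ F)].
  by move=> nF; exfalso; apply/nF/approx_is_cfc.
have /choice[p pP] : forall n : nat, exists q,
    forall t, real_spectrum A t -> `|q.[t] - f t| <= n.+1%:R^-1.
  by move=> n; apply: fp; rewrite invr_gt0.
have [|F pF] := @opnorm_cauchy_cvg (fun n => opoly (p n) A).
  move=> e e0; have e20 : 0 < e / 2 by rewrite divr_gt0.
  have [N hN] := invS_le e20; exists N => m n Nm Nn.
  rewrite -opolyB; apply: opoly_opnorm_le => //; first exact: ltW.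
  move=> t st; rewrite hornerD hornerN -(subrKA (f t)) [leRHS]splitr.
  apply: le_trans (ler_normD _ _) (lerD _ _).
    exact: le_trans (pP m t st) (hN m Nm).
  rewrite distrC; exact: le_trans (pP n t st) (hN n Nn).
exists F => e e0; have [N hN] := pF e e0; have [N' hN'] := invS_le e0.
exists (p (maxn N N')); last by apply: hN; rewrite leq_maxl.
by move=> t st; apply: le_trans (pP _ t st) (hN' _ _); rewrite leq_maxr.
Qed.

Lemma cfc_approx_opoly p : cfc_approx (horner p) A (opoly p A).
Proof.
move=> e e0; exists p => [t _|]; first by rewrite subrr normr0 ltW.
by rewrite subrr; apply: opnorm_le => [|x]; rewrite ?rnorm0 ?mulr_ge0 ?rnorm_ge0 ?ltW.
Qed.

Lemma cfc_approx_id : cfc_approx id A A.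
Proof.
have := cfc_approx_opoly 'X; rewrite opolyX.
by congr cfc_approx; apply/funext => t; rewrite hornerX.
Qed.

Lemma cfc_approx_cst (c : R) : cfc_approx (fun=> c) A (c%:C *: (1 : bounded_op H)).
Proof.
have := cfc_approx_opoly c%:P; rewrite opolyC.
by congr cfc_approx; apply/funext => t; rewrite hornerC.
Qed.

Lemma cfc_approxD f g F G : cfc_approx f A F -> cfc_approx g A G ->
  cfc_approx (fun t => f t + g t) A (F + G).
Proof.
move=> fF gG e e0; have e20 : 0 < e / 2 by rewrite divr_gt0.
have [[p p1 p2] [q q1 q2]] := (fF _ e20, gG _ e20).
exists (p + q) => [t st|].
  rewrite hornerD opprD addrACA [leRHS]splitr.
  by apply: le_trans (ler_normD _ _) (lerD _ _); [exact: p1|exact: q1].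
rewrite opolyD opprD addrACA [leRHS]splitr.
exact: le_trans (opnormD _ _) (lerD p2 q2).
Qed.

Lemma cfc_approxN f F : cfc_approx f A F -> cfc_approx (fun t => - f t) A (- F).
Proof.
move=> fF e e0; have [p p1 p2] := fF e e0; exists (- p) => [t st|].
  by rewrite hornerN -opprD normrN; exact: p1.
by rewrite opolyN -opprD opnormN.
Qed.

Lemma cfc_approxB f g F G : cfc_approx f A F -> cfc_approx g A G ->
  cfc_approx (fun t => f t - g t) A (F - G).
Proof. by move=> fF gG; apply: cfc_approxD => //; exact: cfc_approxN. Qed.

Lemma poly_bounded p (M : R) :
  exists2 K : R, 0 <= K & forall t, `|t| <= M -> `|p.[t]| <= K.
Proof.
elim/poly_ind: p => [|p c [K K0 pK]].
  by exists 0 => // t _; rewrite horner0 normr0.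
exists (K * `|M| + `|c|) => [|t tM]; first by rewrite addr_ge0 ?mulr_ge0.
rewrite hornerMXaddC; apply: le_trans (ler_normD _ _) _.
rewrite lerD2r normrM ler_pM//; first exact: pK.
exact: le_trans tM (ler_norm _).
Qed.

Lemma real_spectrum_norm_le t : real_spectrum A t -> `|t| <= opnorm A.
Proof.
move=> st; rewrite ler_norml (real_spectrum_le sA st) andbT lerNl.
rewrite -opnormN; apply: real_spectrum_le; first exact: selfadjN.
rewrite /real_spectrum /spectrum /= rmorphN/= scaleNr opprK addrC => /bop_invertibleN.
by rewrite opprD opprK addrC.
Qed.

Lemma cfc_approx_bounded f F : cfc_approx f A F ->
  exists2 K : R, 0 <= K & forall t, real_spectrum A t -> `|f t| <= K.
Proof.
move=> fF; have [p p1 _] := fF 1 ltr01.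
have [K K0 pK] := poly_bounded p (opnorm A).
exists (K + 1) => [|t st]; first by rewrite addr_ge0.
rewrite -[f t](subKr p.[t]); apply: le_trans (ler_normB _ _) (lerD _ (p1 t st)).
exact/pK/real_spectrum_norm_le.
Qed.

(** Both sides of the tolerance are controlled by the same expansion
    [ab - a'b' = (a - a')(b - b') + (a - a')b' + a'(b - b')], of polynomial values
    on the spectrum and of operators. *)
Lemma cfc_approxM f g F G : cfc_approx f A F -> cfc_approx g A G ->
  cfc_approx (fun t => f t * g t) A (F * G).
Proof.
move=> fF gG e e0.
have [Kf Kf0 fK] := cfc_approx_bounded fF.
have [Kg Kg0 gK] := cfc_approx_bounded gG.
(* With tolerance [d <= 1], either expansion is at most [d * K]. *)
pose K := Kf + Kg + opnorm F + opnorm G + 2.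
have K0 : 0 < K by rewrite ltr_wpDl// !addr_ge0 ?opnorm_ge0.
have d0 : 0 < Num.min 1 (e / K) by rewrite lt_min ltr01 divr_gt0.
set d := Num.min _ _ in d0.
have d1 : d <= 1 by rewrite ge_min lexx.
have dK : d * K <= e by rewrite -ler_pdivlMr// ge_min lexx orbT.
have [[p p1 p2] [q q1 q2]] := (fF _ d0, gG _ d0).
exists (p * q) => [t st|].
  have -> : (p * q).[t] - f t * g t =
      (p.[t] - f t) * (q.[t] - g t) + (p.[t] - f t) * g t + f t * (q.[t] - g t).
    by rewrite hornerM; ring.
  apply: le_trans (ler_normD _ _) _.
  apply: le_trans (lerD (ler_normD _ _) (lexx _)) _; rewrite !normrM.
  have := p1 t st; have := q1 t st; have := fK t st; have := gK t st.
  have := normr_ge0 (p.[t] - f t); have := normr_ge0 (q.[t] - g t).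
  have := normr_ge0 (f t); have := normr_ge0 (g t).
  have := opnorm_ge0 F; have := opnorm_ge0 G.
  move: `|p.[t] - f t| `|q.[t] - g t| `|f t| `|g t| dK => a b u v.
  rewrite /K; move: (opnorm F) (opnorm G) => x y; clear - d0 d1 Kf0 Kg0; nra.
have -> : opoly (p * q) A - F * G = (opoly p A - F) * (opoly q A - G) +
    (opoly p A - F) * G + F * (opoly q A - G).
  by rewrite opolyM -mulrDr subrK mulrBl mulrBr addrA subrK.
apply: le_trans (opnormD _ _) _.
apply: le_trans (lerD (opnormD _ _) (lexx _)) _.
apply: le_trans (lerD (lerD (opnormM _ _) (opnormM _ _)) (opnormM _ _)) _.
have := opnorm_ge0 F; have := opnorm_ge0 G.
have := opnorm_ge0 (opoly p A - F); have := opnorm_ge0 (opoly q A - G).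
move: p2 q2; move: (opnorm (opoly p A - F)) (opnorm (opoly q A - G)) dK => a b.
rewrite /K; move: (opnorm F) (opnorm G) => x y; clear - d0 d1 Kf0 Kg0; nra.
Qed.

Lemma eq_cfc_approx f g F : (forall t, real_spectrum A t -> f t = g t) ->
  cfc_approx f A F -> cfc_approx g A F.
Proof.
move=> fg fF e e0; have [p p1 p2] := fF e e0; exists p => // t st.
by rewrite -fg// p1.
Qed.

Lemma cfc_approx_selfadj f F : cfc_approx f A F -> selfadj F.
Proof.
move=> fF; suff h x y : rinner (F x) y = rinner x (F y).
  by move=> x y; apply: inner_of_rinner; rewrite ?h// -linearZ h.
apply/eqP; rewrite -subr_eq0 -normr_le0; apply/ler_addgt0Pr => e e0.
pose K := 2 * (rnorm x * rnorm y) + 1.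
have K0 : 0 < K by rewrite ltr_wpDl// !mulr_ge0 ?rnorm_ge0.
have [q _ qF] := fF (e / K) (divr_gt0 e0 K0).
set D := opoly q A - F in qF.
have -> : rinner (F x) y - rinner x (F y) = rinner x (D y) - rinner (D x) y.
  rewrite /D /= rinnerBl rinnerBr (selfadj_rinner (selfadj_opoly q sA)); ring.
have hD u v : `|rinner (D u) v| <= e / K * (rnorm u * rnorm v).
  apply: le_trans (ler_rinner _ _) _; rewrite mulrA ler_wpM2r ?rnorm_ge0//.
  by apply: le_trans (ler_opnorm _ _) _; rewrite ler_wpM2r ?rnorm_ge0.
apply: le_trans (ler_normB _ _) _; rewrite rinnerC.
apply: le_trans (lerD (hD _ _) (hD _ _)) _.
rewrite (mulrC (rnorm y)) -mulrDr add0r mulrAC -mulrA ler_piMr ?(ltW e0)//.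
rewrite ler_pdivrMr// /K; lra.
Qed.

Lemma cfc_approx_pos f F : cfc_approx f A F ->
  (forall t, real_spectrum A t -> 0 <= f t) -> pos_op F.
Proof.
move=> fF f0 x; apply/ler_addgt0Pr => e e0.
pose K := 2 * rnorm x ^+ 2 + 1.
have K0 : 0 < K by rewrite ltr_wpDl// mulr_ge0 ?sqr_ge0.
have d0 := divr_gt0 e0 K0; set d := e / K in d0.
have [q q1 q2] := fF d d0.
have qd0 t : real_spectrum A t -> 0 <= (q + d%:P).[t].
  move=> st; rewrite hornerD hornerC; have := q1 t st; have := f0 t st.
  by rewrite ler_norml; lra.
have := opoly_pos sA qd0 x.
rewrite opolyD opolyC /= rinnerDl rinnerZl rinner_normE => h.
have : rinner ((opoly q A - F) x) x <= d * rnorm x ^+ 2.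
  by apply: le_trans (ler_op_rinner _ _) _; rewrite ler_wpM2r ?sqr_ge0.
rewrite /= rinnerBl => h'.
have : d * K = e by rewrite /d divfK// gt_eqF.
have : d * K = 2 * (d * rnorm x ^+ 2) + d by rewrite /K; ring.
lra.
Qed.

Lemma cfc_approx_norm_le f F (c : R) : cfc_approx f A F -> 0 <= c ->
  (forall t, real_spectrum A t -> `|f t| <= c) -> opnorm F <= c.
Proof.
move=> fF c0 fc; apply/ler_addgt0Pr => e e0.
have e20 : 0 < e / 2 by rewrite divr_gt0.
have [q q1 q2] := fF _ e20.
rewrite -[F](subKr (opoly q A)); apply: le_trans (opnormD _ _) _.
rewrite opnormN [e]splitr addrA lerD//.
apply: opoly_opnorm_le => //; first by rewrite addr_ge0// ltW.
move=> t st; rewrite -[q.[t]](subrKC (f t)).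
by apply: le_trans (ler_normD _ _) (lerD _ _); [exact: fc|exact: q1].
Qed.

Lemma cfc_approx_unique f F G : cfc_approx f A F -> cfc_approx f A G -> F = G.
Proof.
move=> fF fG; apply/eqP; rewrite -subr_eq0; apply/eqP/opnorm_le_eq0.
apply: (cfc_approx_norm_le (cfc_approxB fF fG)) => // t _.
by rewrite subrr normr0.
Qed.

End calculus_rules.

Section positive_operator.
Variables (A : bounded_op H) (sA : selfadj A) (pA : pos_op A).

Lemma cfcP f : {within `[0, +oo[, continuous f} -> cfc_approx f A (cfc f A).
Proof.
move=> cf; apply: cfc_exists => // e e0.
have M0 : 0 < opnorm A + 1 by rewrite ltr_wpDl ?opnorm_ge0.
have cf' : {within `[0, opnorm A + 1], continuous f}.
  apply: continuous_subspaceW cf => t /=; rewrite !in_itv/= andbT.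
  by case/andP.
have [q hq] := weierstrass_approximation M0 cf' e0.
exists q => t st; apply: hq; rewrite (real_spectrum_ge0 sA pA st)/=.
by apply: le_trans (real_spectrum_le sA st) _; rewrite lerDl.
Qed.

End positive_operator.

(** Polynomials intertwine exactly, and a single polynomial approximates [h] on an
    interval that contains the spectra of both [A] and [B]. *)
Lemma cfc_intertwine (X A B : bounded_op H) h :
  selfadj A -> pos_op A -> selfadj B -> pos_op B ->
  {within `[0, +oo[, continuous h} ->
  X * A = B * X -> X * cfc h A = cfc h B * X.
Proof.
move=> sA pA sB pB ch XAB; apply/eqP; rewrite -subr_eq0; apply/eqP/opnorm_le_eq0.
apply/ler_addgt0Pr => e e0; rewrite add0r.
pose K := 2 * opnorm X + 1.
have K0 : 0 < K by rewrite ltr_wpDl// mulr_ge0 ?opnorm_ge0.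
pose M := opnorm A + opnorm B + 1.
have M0 : 0 < M by rewrite ltr_wpDl ?addr_ge0 ?opnorm_ge0.
have ch' : {within `[0, M], continuous h}.
  apply: continuous_subspaceW ch => t /=; rewrite !in_itv/= andbT.
  by case/andP.
have d0 := divr_gt0 e0 K0.
have [q hq] := weierstrass_approximation M0 ch' d0.
have near_cfc (C : bounded_op H) : selfadj C -> pos_op C -> opnorm C <= M ->
    opnorm (opoly q C - cfc h C) <= e / K.
  move=> sC pC CM; apply: (cfc_approx_norm_le sC (cfc_approxB
    (@cfc_approx_opoly C q) (cfcP sC pC ch)) (ltW d0)) => t st.
  apply: hq; rewrite (real_spectrum_ge0 sC pC st)/=.
  exact: le_trans (real_spectrum_le sC st) _.
have hA : opnorm (opoly q A - cfc h A) <= e / K.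
  by apply: near_cfc => //; have := opnorm_ge0 B; rewrite /M; lra.
have hB : opnorm (opoly q B - cfc h B) <= e / K.
  by apply: near_cfc => //; have := opnorm_ge0 A; rewrite /M; lra.
have -> : X * cfc h A - cfc h B * X =
    (opoly q B - cfc h B) * X - X * (opoly q A - cfc h A).
  by rewrite mulrBl mulrBr (opoly_intertwine q XAB) opprB [RHS]addrC addrA subrK.
apply: le_trans (opnormD _ _) _; rewrite opnormN.
apply: le_trans (lerD (opnormM _ _) (opnormM _ _)) _.
apply: (@le_trans _ _ (e / K * K)); last by rewrite divfK// gt_eqF.
have X0 := opnorm_ge0 X.
apply: le_trans (lerD (ler_wpM2r X0 hB) (ler_wpM2l X0 hA)) _.
rewrite [leLHS](_ : _ = e / K * (2 * opnorm X)).
  by rewrite ler_pM2l// /K lerDl.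
by rewrite [opnorm X * _]mulrC -mulrDr mulr_natl -mulr2n.
Qed.

End functional_calculus.

(** * Absolute value and the mixed Schwarz inequality *)

Section absolute_value.
Variables (R : realType) (H : hilbertType R).
Implicit Types (T : bounded_op H) (f g h : R -> R).

Lemma adjointM_pos T : pos_op (adjoint T * T).
Proof.
by move=> x /=; rewrite /rinner adjointPr -/(rinner _ _) rinner_normE sqr_ge0.
Qed.

Lemma sqrt_within_continuous : {within `[0, +oo[, continuous (@Num.sqrt R)}.
Proof. by apply: continuous_subspaceT; exact: sqrt_continuous. Qed.

Lemma absop_approx T : cfc_approx (@Num.sqrt R) (adjoint T * T) (absop T).
Proof.
apply: cfcP; [exact: selfadj_adjointM|exact: adjointM_pos|].
exact: sqrt_within_continuous.
Qed.

Lemma absop_selfadj T : selfadj (absop T).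
Proof. exact: cfc_approx_selfadj (@selfadj_adjointM _ _ T) _ _ (absop_approx T). Qed.

Lemma absop_pos T : pos_op (absop T).
Proof.
by apply: (cfc_approx_pos (@selfadj_adjointM _ _ T) (absop_approx T)) => t _.
Qed.

Lemma absop_sqr T : absop T * absop T = adjoint T * T.
Proof.
have sT := @selfadj_adjointM _ _ T; have aT := absop_approx T.
apply: (cfc_approx_unique sT (cfc_approxM sT aT aT)).
apply: eq_cfc_approx (cfc_approx_id _) => t st.
by rewrite -expr2 sqr_sqrtr// (real_spectrum_ge0 sT (@adjointM_pos T) st).
Qed.

Lemma rnorm_absop T x : rnorm (absop T x) = rnorm (T x).
Proof.
apply/eqP; rewrite -(@eqrXn2 _ 2%N) ?rnorm_ge0// -!rinner_normE.
rewrite (selfadj_rinner (@absop_selfadj T)).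
rewrite -[absop T (absop T x)]/((absop T * absop T) x) absop_sqr /=.
by rewrite rinnerC /rinner adjointPr.
Qed.

Lemma cfc_absop_approx T f : {within `[0, +oo[, continuous f} ->
  cfc_approx f (absop T) (cfc f (absop T)).
Proof. apply: cfcP; [exact: absop_selfadj|exact: absop_pos]. Qed.

(** [T] intertwines [T^* T] and [T T^*], hence their square roots, hence the
    functions of these. *)
Lemma absop_intertwine T h : {within `[0, +oo[, continuous h} ->
  T * cfc h (absop T) = cfc h (absop (adjoint T)) * T.
Proof.
move=> ch; apply: cfc_intertwine => //.
- exact: absop_selfadj.
- exact: absop_pos.
- exact: absop_selfadj.
- exact: absop_pos.
apply: cfc_intertwine.
- exact: selfadj_adjointM.
- exact: adjointM_pos.
- exact: selfadj_adjointM.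
- exact: adjointM_pos.
- exact: sqrt_within_continuous.
by rewrite adjointK mulrA.
Qed.

(** With [h = f / (f^2 + d^2)] split [T = T h(A) f(A) + T (1 - h f)(A)], where
    [A = |T|] and [B = |T^*|].  Moving [T h(A) = h(B) T] across the inner product
    leaves [T^* h(B) y], of norm [ |B h(B) y| <= |g(B) y| ] since [t h(t)] is [g(t)]
    times a number between 0 and 1; the remainder has the norm of [A (1 - h f)(A)], which is
    of order [d]. *)
Theorem mixed_schwarz T f g (x y : H) :
  {within `[0, +oo[, continuous f} -> {within `[0, +oo[, continuous g} ->
  (forall t, 0 <= t -> f t * g t = t) ->
  rnorm (inner (T x) y) <=
    rnorm (cfc f (absop T) x) * rnorm (cfc g (absop (adjoint T)) y).
Proof.
move=> cf cg fg; set A := absop T; set B := absop (adjoint T).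
have [sA pA] : selfadj A /\ pos_op A.
  by split; [exact: absop_selfadj|exact: absop_pos].
have [sB pB] : selfadj B /\ pos_op B.
  by split; [exact: absop_selfadj|exact: absop_pos].
have fA : cfc_approx f A (cfc f A) by exact: cfcP.
have gB : cfc_approx g B (cfc g B) by exact: cfcP.
have gA : cfc_approx g A (cfc g A) by exact: cfcP.
have AT z : rnorm (A z) = rnorm (T z) by exact: rnorm_absop.
have BT z : rnorm (B z) = rnorm (adjoint T z) by exact: rnorm_absop.
have TAB h : {within `[0, +oo[, continuous h} -> T * cfc h A = cfc h B * T.
  exact: absop_intertwine.
clearbody A B.
move: fA gB gA; move: (cfc f A) (cfc g B) (cfc g A) => FA GB GA fA gB gA.
have [G G0 gG] := cfc_approx_bounded sA gA.
apply/ler_addgt0Pr => e e0.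
pose K := G * (rnorm x * rnorm y) + 1.
have K0 : 0 < K by rewrite ltr_wpDl// !mulr_ge0 ?rnorm_ge0.
have d0 := divr_gt0 e0 K0; set d := e / K in d0.
pose h t := f t / (f t ^+ 2 + d ^+ 2).
have den t : 0 < f t ^+ 2 + d ^+ 2 by rewrite ltr_wpDl ?sqr_ge0 ?exprn_gt0.
have ch : {within `[0, +oo[, continuous h}.
  move=> t; apply: cvgM; first exact: cf.
  apply: cvgV; first by rewrite gt_eqF.
  by apply: cvgD; [apply: cvgM; exact: cf|exact: cvg_cst].
have hA : cfc_approx h A (cfc h A) by exact: cfcP.
have hB : cfc_approx h B (cfc h B) by exact: cfcP.
move: (TAB h ch) hA hB; move: (cfc h A) (cfc h B) => HA HB TH hA hB.
pose D := (1%:C *: (1 : bounded_op H)) - HA * FA.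
have DA : cfc_approx (fun t => 1 - h t * f t) A D.
  by apply: cfc_approxB; [exact: cfc_approx_cst|exact: cfc_approxM].
have TE : T x = T (HA (FA x)) + T (D x).
  by rewrite -linearD /D /= scale1r addrC subrK.
have ADle : opnorm (A * D) <= G * d.
  apply: (cfc_approx_norm_le sA (cfc_approxM sA (@cfc_approx_id _ _ A) DA)).
    by rewrite mulr_ge0// ltW.
  move=> t st; have t0 := real_spectrum_ge0 sA pA st.
  (* [f d / (f^2 + d^2)] is at most 1 in absolute value. *)
  have -> : t * (1 - h t * f t) = g t * (d * (f t * d / (f t ^+ 2 + d ^+ 2))).
    by rewrite -{1}(fg _ t0) /h; field; rewrite gt_eqF.
  rewrite normrM ler_pM//; first exact: gG.
  rewrite normrM (gtr0_norm d0) ler_piMr ?(ltW d0)//.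
  rewrite normrM normfV (gtr0_norm (den t)) ler_pdivrMr// mul1r ler_norml.
  by have := sqr_ge0 (f t - d); have := sqr_ge0 (f t + d); nra.
(* The constant [K] in [d = e / K] was chosen for this bound. *)
have TD : rnorm (inner (T (D x)) y) <= e.
  apply: le_trans (ler_inner _ _) _.
  apply: (@le_trans _ _ (G * d * rnorm x * rnorm y)).
    rewrite ler_wpM2r ?rnorm_ge0// -AT.
    apply: le_trans (ler_opnorm (A * D) x) _.
    by rewrite ler_wpM2r ?rnorm_ge0.
  have -> : G * d * rnorm x * rnorm y = d * (G * (rnorm x * rnorm y)) by ring.
  rewrite /d mulrAC -mulrA ler_piMr ?(ltW e0)//.
  rewrite ler_pdivrMr// mul1r /K; lra.
have BhB : rnorm (adjoint T (HB y)) <= rnorm (GB y).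
  rewrite -BT -ler_sqr ?nnegrE ?rnorm_ge0// -!rinner_normE.
  have BhBB := cfc_approxM sB (@cfc_approx_id _ _ B) hB.
  have sBh := cfc_approx_selfadj sB BhBB.
  rewrite -[B (HB y)]/((B * HB) y) (selfadj_rinner sBh).
  rewrite (selfadj_rinner (cfc_approx_selfadj sB gB)).
  have : pos_op (GB * GB - B * HB * (B * HB)).
    apply: (cfc_approx_pos sB (cfc_approxB (cfc_approxM sB gB gB)
      (cfc_approxM sB BhBB BhBB))) => t st.
    have t0 := real_spectrum_ge0 sB pB st.
    have -> : id t * h t = g t * (f t ^+ 2 / (f t ^+ 2 + d ^+ 2)).
      by rewrite /= -{1}(fg _ t0) /h; field; rewrite gt_eqF.
    set u := _ / _.
    have u0 : 0 <= u by rewrite divr_ge0 ?sqr_ge0// ltW.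
    have u1 : u <= 1 by rewrite ler_pdivrMr// mul1r lerDl sqr_ge0.
    have -> : g t * g t - g t * u * (g t * u) = g t ^+ 2 * ((1 - u) * (1 + u)).
      by ring.
    by rewrite mulr_ge0 ?sqr_ge0// mulr_ge0 ?subr_ge0// addr_ge0.
  by move=> /(_ y); rewrite /= rinnerBl subr_ge0 !(rinnerC y).
rewrite TE (linearDl inner); apply: le_trans (ler_rnormD _ _) (lerD _ TD).
rewrite -[T (HA _)]/((T * HA) (FA x)) TH /=.
rewrite (cfc_approx_selfadj sB hB) adjointP.
by apply: le_trans (ler_inner _ _) _; rewrite ler_wpM2l ?rnorm_ge0.
Qed.

End absolute_value.

(** * From operator matrices to scalar matrices *)

Section mccarthy.
Variables (R : realType) (H : hilbertType R).
Implicit Types (S P : bounded_op H).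

(** What [P = |S|^(2p)] satisfies because [t `^ p] lies above its tangent at [s];
    with [s = |S u|^2] and [u] a unit vector it is the inequality of McCarthy,
    [ |S u|^(2p) <= <P u, u> ]. *)
Definition mccarthy_tangent S P (p : R) := forall (s : R) (u : H), 0 <= s ->
  p * s `^ (p - 1) * rnorm (S u) ^+ 2 - (p - 1) * s `^ p * rnorm u ^+ 2 <=
  rinner (P u) u.

Lemma cfc_mccarthy_tangent S (p : R) : 1 <= p ->
  mccarthy_tangent S (cfc (fun t => t `^ (2 * p)) (absop S)) p.
Proof.
move=> p1 s u s0; set A := absop S.
have [sA pA] : selfadj A /\ pos_op A.
  by split; [exact: absop_selfadj|exact: absop_pos].
have AS : rnorm (S u) = rnorm (A u) by rewrite rnorm_absop.
have : cfc_approx (fun t => t `^ (2 * p)) A (cfc (fun t => t `^ (2 * p)) A).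
  by apply: cfc_absop_approx; apply: powR_within_continuous; lra.
move: (cfc _ A) => F FA; rewrite AS; clearbody A.
pose c := p * s `^ (p - 1); pose d := (p - 1) * s `^ p.
have idA := @cfc_approx_id _ _ A.
have : pos_op (F - ((c%:C *: (1 : bounded_op H)) * (A * A)
                    - d%:C *: (1 : bounded_op H))).
  apply: (cfc_approx_pos sA (cfc_approxB FA (cfc_approxB
    (cfc_approxM sA (@cfc_approx_cst _ _ A c) (cfc_approxM sA idA idA))
    (@cfc_approx_cst _ _ A d)))) => t st.
  have t0 := real_spectrum_ge0 sA pA st.
  rewrite subr_ge0 /= powRrM powR_mulrn// -expr2.
  by apply: powR_tangent => //; exact: sqr_ge0.
move=> /(_ u); rewrite /= !rinnerBl !rinnerZl rinner_normE.
by rewrite (selfadj_rinner sA) rinner_normE subr_ge0.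
Qed.

End mccarthy.

Section entry_estimates.
Variables (R : realType) (H : hilbertType R) (f g : R -> R).
Hypothesis f_cont : {within `[0, +oo[, continuous f}.
Hypothesis g_cont : {within `[0, +oo[, continuous g}.
Hypothesis fg : forall t, 0 <= t -> f t * g t = t.
Variable T : bounded_op H.

Let F := cfc f (absop T).
Let G := cfc g (absop (adjoint T)).

Let selfadjF : selfadj F.
Proof.
exact: cfc_approx_selfadj (@absop_selfadj _ _ _) _ _ (cfc_absop_approx _ f_cont).
Qed.

Let selfadjG : selfadj G.
Proof.
exact: cfc_approx_selfadj (@absop_selfadj _ _ _) _ _ (cfc_absop_approx _ g_cont).
Qed.

Lemma inner_diag_le (x : H) :
  rnorm (inner (T x) x) <= 2^-1 * opnorm (F ^+ 2 + G ^+ 2) * (rnorm x * rnorm x).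
Proof.
apply: le_trans (mixed_schwarz T x x f_cont g_cont fg) _.
rewrite -/F -/G; move: F G selfadjF selfadjG => P Q sP sQ.
apply: (@le_trans _ _ (2^-1 * (rnorm (P x) ^+ 2 + rnorm (Q x) ^+ 2))).
  move: (rnorm (P x)) (rnorm (Q x)) => a b.
  by have := sqr_ge0 (a - b); rewrite sqrrB -mulr_natl; lra.
rewrite -mulrA ler_pM2l ?invr_gt0// !selfadj_sqrE// -rinnerDl -expr2.
exact: ler_op_rinner (P ^+ 2 + Q ^+ 2) x.
Qed.

Lemma inner_offdiag_le (x y : H) :
  rnorm (inner (T x) y) <=
  Num.sqrt (opnorm (F ^+ 2)) * Num.sqrt (opnorm (G ^+ 2)) * (rnorm x * rnorm y).
Proof.
apply: le_trans (mixed_schwarz T x y f_cont g_cont fg) _.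
rewrite -/F -/G; move: F G selfadjF selfadjG => P Q sP sQ.
by rewrite mulrACA ler_pM ?rnorm_ge0// selfadj_norm_le.
Qed.

End entry_estimates.

Section matrix_estimates.
Variables (R : realType) (H : hilbertType R) (n : nat).
Implicit Types (T : 'M[bounded_op H]_n) (A : 'M[R]_n) (x : hsum H n).

Lemma rnorm_hsum (K : hilbertType R) (x : hsum K n) :
  rnorm x ^+ 2 = \sum_i rnorm (x i) ^+ 2.
Proof.
apply: complexI; rewrite rmorphXn/= rnormE hsum_normE rmorph_sum/=.
by apply: eq_bigr => i _; rewrite rmorphXn/= rnormE.
Qed.

Definition coord_norms x : hsum (cline R) n := [ffun i => (rnorm (x i))%:C : cline R].

Lemma rnorm_real (a : R) : rnorm (a%:C : cline R) = `|a|.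
Proof.
by apply: complexI; rewrite rnormE normc_def /= expr0n addr0 sqrtr_sqr.
Qed.

Lemma rnorm_coord_norms x : rnorm (coord_norms x) = rnorm x.
Proof.
apply/eqP; rewrite -(@eqrXn2 _ 2%N) ?rnorm_ge0// !rnorm_hsum; apply/eqP.
by apply: eq_bigr => i _; rewrite ffunE rnorm_real ger0_norm ?rnorm_ge0.
Qed.

Lemma scalar_opmx_coord A x i : scalar_opmx A (coord_norms x) i =
  (\sum_j A i j * rnorm (x j))%:C.
Proof.
rewrite /scalar_opmx /= ffunE rmorph_sum/=; apply: eq_bigr => j _.
by rewrite mxE ffunE /= rmorphM.
Qed.

Lemma rinner_scalar_opmx A x :
  rinner (scalar_opmx A (coord_norms x)) (coord_norms x) =
  \sum_i \sum_j A i j * (rnorm (x j) * rnorm (x i)).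
Proof.
rewrite /rinner -[inner _ _]/(hsum_inner _ _) /hsum_inner.
rewrite raddf_sum; apply: eq_bigr => i _.
rewrite scalar_opmx_coord ffunE -[inner _ _]/(complex_inner _ _) /complex_inner.
apply: etrans (Re_mul_real _ _) _; rewrite /= mulr_suml.
by apply: eq_bigr => j _; rewrite mulrA.
Qed.

Lemma rnorm_opmx_le T x :
  rnorm (opmx T x) <=
  rnorm (scalar_opmx (\matrix_(i, j) opnorm (T i j)) (coord_norms x)).
Proof.
rewrite -ler_sqr ?nnegrE ?rnorm_ge0// !rnorm_hsum; apply: ler_sum => i _.
rewrite scalar_opmx_coord rnorm_real.
rewrite ler_sqr ?nnegrE ?rnorm_ge0//; apply: le_trans (ler_norm _).
rewrite /= ffunE; apply: le_trans (ler_rnorm_sum _ _) _.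
by apply: ler_sum => j _; rewrite mxE ler_opnorm.
Qed.

(** A quadratic form only sees the symmetric part of its matrix: this is where the
    off-diagonal entries of [R] come from. *)
Lemma rnorm_inner_opmx_le T A x :
  (forall i j,
     rnorm (inner (T i j (x j)) (x i)) <= A i j * (rnorm (x j) * rnorm (x i))) ->
  rnorm (inner (opmx T x) x) <=
  rinner (scalar_opmx (2^-1 *: (A + A^T)) (coord_norms x)) (coord_norms x).
Proof.
move=> TA; rewrite rinner_scalar_opmx.
have -> : \sum_i \sum_j (2^-1 *: (A + A^T)) i j * (rnorm (x j) * rnorm (x i)) =
    \sum_i \sum_j A i j * (rnorm (x j) * rnorm (x i)).
  pose a i j := A i j * (rnorm (x j) * rnorm (x i)).
  rewrite -/(\sum_i \sum_j a i j).
  transitivity (2^-1 * (\sum_i \sum_j a i j + \sum_i \sum_j a j i)).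
    rewrite -big_split mulr_sumr; apply: eq_bigr => i _.
    rewrite -big_split mulr_sumr; apply: eq_bigr => j _.
    by rewrite !mxE /a /=; ring.
  rewrite [X in _ + X]exchange_big/=; move: (\sum_i _) => z; lra.
rewrite -[inner _ _]/(hsum_inner _ _) /hsum_inner.
apply: le_trans (ler_rnorm_sum _ _) _; apply: ler_sum => i _.
rewrite /= ffunE (linear_sumlz inner).
apply: le_trans (ler_rnorm_sum _ _) _; apply: ler_sum => j _.
exact: TA.
Qed.

End matrix_estimates.

Lemma sqrt_powR (R : realType) (s p : R) : 0 <= s ->
  Num.sqrt s `^ p = Num.sqrt (s `^ p).
Proof.
by move=> s0; rewrite -(powR12_sqrt s0) -(powR12_sqrt (powR_ge0 s p)) powRAC.
Qed.

(** Both tangents are taken at the weighted mean [w] of [ |A u|^2 ] and [ |B u|^2 ],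
    so that their weighted sum is exactly [w `^ p]. *)
Lemma alpha_norm_powR_le (R : realType) (H K : hilbertType R) (T : bounded_op H)
    (A B PA PB : bounded_op K) (v : H -> K) (alpha p : R) :
  0 <= alpha -> alpha <= 1 -> 1 <= p ->
  mccarthy_tangent A PA p -> mccarthy_tangent B PB p ->
  (forall x, rnorm (v x) = rnorm x) ->
  (forall x, rnorm x = 1 -> rnorm (inner (T x) x) <= rnorm (A (v x))) ->
  (forall x, rnorm x = 1 -> rnorm (T x) <= rnorm (B (v x))) ->
  alpha_norm alpha T `^ p <=
  Num.sqrt (opnorm (alpha%:C *: PA + (1 - alpha)%:C *: PB)).
Proof.
move=> alpha_ge0 alpha_le1 p_ge1 tangentA tangentB vnorm TA TB.
have p0 : 0 < p by exact: lt_le_trans p_ge1.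
have beta0 : 0 <= 1 - alpha by rewrite subr_ge0.
set N := opnorm _.
pose q x := alpha * rnorm (inner (T x) x) ^+ 2 + (1 - alpha) * rnorm (T x) ^+ 2.
have q0 x : 0 <= q x by rewrite addr_ge0// mulr_ge0 ?sqr_ge0.
have key x : rnorm x = 1 -> q x `^ p <= N.
  move=> x1; set u := v x; have u1 : rnorm u = 1 by rewrite /u vnorm.
  pose r := rnorm (A u) ^+ 2; pose s := rnorm (B u) ^+ 2.
  pose w := alpha * r + (1 - alpha) * s.
  have w0 : 0 <= w by rewrite addr_ge0// mulr_ge0 ?sqr_ge0.
  have qw : q x <= w.
    by rewrite lerD// ler_wpM2l// ler_sqr ?nnegrE ?rnorm_ge0// ?TA ?TB.
  apply: (@le_trans _ _ (w `^ p)).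
    by apply: ge0_ler_powR => //; rewrite ?nnegrE ?(ltW p0).
  have hA := tangentA w u w0; have hB := tangentB w u w0.
  rewrite u1 expr1n mulr1 -/r in hA; rewrite u1 expr1n mulr1 -/s in hB.
  have wE := mulr_powRB1 w0 p0.
  have := ler_op_rinner (alpha%:C *: PA + (1 - alpha)%:C *: PB) u.
  rewrite -/N u1 expr1n mulr1; apply: le_trans.
  rewrite /= rinnerDl !rinnerZl.
  apply: le_trans (lerD (ler_wpM2l alpha_ge0 hA) (ler_wpM2l beta0 hB)).
  rewrite le_eqVlt; apply/orP; left; apply/eqP.
  transitivity (p * (w * w `^ (p - 1)) - (p - 1) * w `^ p); first by rewrite wE; ring.
  by rewrite {1}/w; ring.
(* Without unit vectors, the supremum of the empty set is 0. *)
have [[x0 x01]|V0] := pselect (exists x : H, rnorm x = 1); last first.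
  rewrite /alpha_norm (_ : [set _ | _ in _] = set0).
    by rewrite sup0 powR0 ?gt_eqF// sqrtr_ge0.
  by apply/seteqP; split => // _ [x /= x1 _]; apply: V0; exists x.
have val_le x : rnorm x = 1 -> Num.sqrt (q x) <= Num.sqrt N `^ p^-1.
  move=> x1; have -> : Num.sqrt (q x) = (Num.sqrt (q x) `^ p) `^ p^-1.
    by rewrite -powRrM mulfV ?gt_eqF// powRr1 ?sqrtr_ge0.
  apply: ge0_ler_powR; rewrite ?nnegrE ?invr_ge0 ?(ltW p0) ?powR_ge0 ?sqrtr_ge0//.
  by rewrite sqrt_powR// ler_wsqrtr// key.
have norm_le : alpha_norm alpha T <= Num.sqrt N `^ p^-1.
  apply: ge_sup; first by exists (Num.sqrt (q x0)), x0.
  by move=> _ [x /= x1 <-]; exact: val_le.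
have norm_ge0 : 0 <= alpha_norm alpha T.
  apply: le_trans (sqrtr_ge0 (q x0)) _; apply: ub_le_sup; last by exists x0.
  by exists (Num.sqrt N `^ p^-1) => _ [x /= x1 <-]; exact: val_le.
apply: le_trans (_ : (Num.sqrt N `^ p^-1) `^ p <= _).
  by apply: ge0_ler_powR; rewrite ?nnegrE ?powR_ge0 ?(ltW p0).
by rewrite -powRrM mulVf ?gt_eqF// powRr1 ?sqrtr_ge0.
Qed.

Theorem theorem2p13 (R : realType) (H : hilbertType R) (alpha : R)
    (alpha_ge0 : 0 <= alpha) (alpha_le1 : alpha <= 1)
    (n : nat) (T : 'M[bounded_op H]_n) (f g : R -> R)
    (f_ge0 : forall t, 0 <= t -> 0 <= f t)
    (g_ge0 : forall t, 0 <= t -> 0 <= g t)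
    (f_cont : {within `[0, +oo[, continuous f})
    (g_cont : {within `[0, +oo[, continuous g})
    (fg : forall t, 0 <= t -> f t * g t = t)
    (p : R) (p_ge1 : 1 <= p) :
  let f2 (A : bounded_op H) := cfc f (absop A) ^+ 2 in
  let g2 (A : bounded_op H) := cfc g (absop (adjoint A)) ^+ 2 in
  let Rm : 'M[R]_n := \matrix_(i, j)
    if i == j then 2^-1 * opnorm (f2 (T i i) + g2 (T i i))
    else 2^-1 *
      (Num.sqrt (opnorm (f2 (T i j))) * Num.sqrt (opnorm (g2 (T i j)))
       + Num.sqrt (opnorm (f2 (T j i))) * Num.sqrt (opnorm (g2 (T j i)))) in
  let Sm : 'M[R]_n := \matrix_(i, j) opnorm (T i j) in
  let abs_pow (A : 'M[R]_n) :=
    cfc (fun t => t `^ (2 * p)) (absop (scalar_opmx A)) in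
  alpha_norm alpha (opmx T) `^ p <=
  Num.sqrt (opnorm (alpha%:C *: abs_pow Rm + (1 - alpha)%:C *: abs_pow Sm)).
Proof.
cbv zeta.
apply: (alpha_norm_powR_le (v := @coord_norms R H n) alpha_ge0 alpha_le1 p_ge1
  (cfc_mccarthy_tangent _ p_ge1) (cfc_mccarthy_tangent _ p_ge1)) => [x|x x1|x _];
  [exact: rnorm_coord_norms| |exact: rnorm_opmx_le].
have coord1 : rnorm (coord_norms x) = 1 by rewrite rnorm_coord_norms.
set Rm := (X in scalar_opmx X).
pose A : 'M[R]_n := \matrix_(i, j) if i == j
  then 2^-1 * opnorm (cfc f (absop (T i i)) ^+ 2 + cfc g (absop (adjoint (T i i))) ^+ 2)
  else Num.sqrt (opnorm (cfc f (absop (T i j)) ^+ 2)) *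
       Num.sqrt (opnorm (cfc g (absop (adjoint (T i j))) ^+ 2)).
have RmE : Rm = 2^-1 *: (A + A^T).
  apply/matrixP => i j; rewrite !mxE (eq_sym j); case: eqVneq => [->|_]; last by [].
  move: (2^-1 * _) => z; lra.
rewrite RmE.
have Ax : rnorm (inner (opmx T x) x) <=
    rinner (scalar_opmx (2^-1 *: (A + A^T)) (coord_norms x)) (coord_norms x).
  apply: rnorm_inner_opmx_le => i j; rewrite mxE; case: eqVneq => [->|_].
    exact: inner_diag_le.
  exact: inner_offdiag_le.
apply: le_trans Ax _; apply: le_trans (ler_norm _) _.
by apply: le_trans (ler_rinner _ _) _; rewrite coord1 mulr1.
Qed.
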